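(* Let a network $G=(J,P,\gamma)$ be given, as described in the context. There exists $\varepsilon>0$ such that for every constant external inflow rate vector $\lambda=(\lambda_j)_{j\in J}$ with $0\le\lambda_j<\varepsilon$ for all $j\in J$, the non-linear Markov process (NLMP) with data $(J,P,\gamma,\lambda)$ has a unique stationary state (equilibrium) $\mu^\lambda\in\mathcal P(X)$, and for every finite-weight initial measure $\mu_0\in\mathcal P(X)$ the NLMP dynamics $\mu_t$ started from $\mu_0$ converges to $\mu^\lambda$: for every $x\in X$, $$\lim_{t\to\infty}|\mu_t(x)-\mu^\lambda(x)|=0.$$
   Context: Network data. $J$ is a finite set of customer classes. $P=(p_{ij})_{i,j\in J}$ is the routing matrix: $p_{ij}\ge 0$, $\sum_{j}p_{ij}\le 1$ for every $i$, and the network is open, i.e. the spectral radius of $P$ is less than $1$. $X=J^*=\bigcup_{k\ge 0}J^k$ is the countable set of finite words (queues) $x=(x_1,\dots,x_k)$, $|x|=k$, with empty word $\varnothing$. For $x\in X$ and $j\in J$, $x\oplus j$ is the word $x$ with $j$ appended at the end; for $1\le r\le|x|$, $x\ominus_r$ is $x$ with its $r$-th letter deleted. Service rates $\gamma(x,r)\ge 0$ ($x\in X$, $1\le r\le |x|$) are given, where $\gamma(x,r)$ is the rate at which the $r$-th customer of the queue $x$ is served. The total rate $\gamma(x)=\sum_{r=1}^{|x|}\gamma(x,r)$ satisfies $\gamma_-\le\gamma(x)\le\gamma_+$ for all $x\ne\varnothing$, for some constants $0<\gamma_-\le\gamma_+<\infty$. $\mathcal P(X)$ is the set of probability measures on $X$.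 NLMP dynamics. Given constant external inflow rates $\lambda_j\ge0$, the evolution $(\mu_t)_{t\ge 0}$ in $\mathcal P(X)$ with initial state $\mu_0$ is the unique solution (existence and uniqueness are known when the inflow rates $\lambda_j$ are bounded and $\gamma_-\le\gamma(x)\le\gamma_+$ for all $x\ne\varnothing$ with $0<\gamma_-\le\gamma_+<\infty$) of $$\dot\mu_t=\sum_{x\in X}\mu_t(x)\Big[\sum_{r=1}^{|x|}\gamma(x,r)(\delta_{x\ominus_r}-\delta_x)+\sum_{j\in J}v_j(t)(\delta_{x\oplus j}-\delta_x)\Big],$$ where $$u_j(t)=\sum_{x\in X}\mu_t(x)\sum_{r:\,x_r=j}\gamma(x,r),\qquad v_j(t)=\lambda_j+\sum_{i\in J}p_{ij}u_i(t).$$ A stationary state is a $\mu\in\mathcal P(X)$ such that $\mu_t\equiv\mu$ is a solution. A measure $\mu\in\mathcal P(X)$ is finite-weight if $\sum_{x}|x|\mu(x)<\infty$. *)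

(* Defs.v *)
From HB Require Import structures.
From mathcomp Require Import all_boot all_order all_algebra.
From mathcomp Require Import complex.
From mathcomp Require Import all_classical all_reals all_analysis.
Set Implicit Arguments.
Unset Strict Implicit.
Unset Printing Implicit Defensive.
Import Order.TTheory GRing.Theory Num.Theory.
Import numFieldNormedType.Exports.
Local Open Scope classical_set_scope.
Local Open Scope ring_scope.

(* The spectral radius of a real matrix is taken over its complex eigenvalues
   ([sup set0 = 0] gives 0 for the 0 x 0 matrix). *)
Definition spectral_radius (R : realType) (n : nat) (A : 'M[R]_n) : R :=
  sup [set Normc.normc z | z in
         [set z : R[i] | eigenvalue (map_mx (real_complex R) A) z]].

Definition routing_matrix (R : realType) (J : finType) (p : J -> J -> R) :
    'M[R]_#|J| :=
  \matrix_(i, j) p (enum_val i) (enum_val j).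

(* Every subset of the countable space J^* is measurable, so a [probability] on
   [word J] is determined by its masses on singletons and an integral against
   it is a sum over J^* weighted by those masses. *)
Definition word (J : finType) := seq J.

HB.instance Definition _ (J : finType) := Countable.on (word J).
HB.instance Definition _ (J : finType) := isPointed.Build (word J) [::].
HB.instance Definition _ (J : finType) :=
  @isMeasurable.Build default_measure_display (word J) discrete_measurable
    discrete_measurable0 discrete_measurableC discrete_measurableU.

Section nlmp.
Context (R : realType) (J : finType).
Implicit Types (mu : probability (word J) R) (x y : word J) (v : J -> R).

(* Positions are 0-based ordinals: [r : 'I_(size x)] is position r + 1. *)
Definition service_rates := forall x : word J, 'I_(size x) -> R.

Definition delete_at x (r : nat) : word J := take r x ++ drop r.+1 x.

Definition total_rate (gamma : service_rates) x : R :=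
  \sum_(r < size x) gamma x r.

Definition class_rate (gamma : service_rates) (j : J) x : R :=
  \sum_(r < size x | tnth (in_tuple x) r == j) gamma x r.

Definition mass mu x : R := fine (mu [set x]).

Definition finite_weight mu : Prop :=
  (\int[mu]_x ((size x)%:R : R)%:E < +oo)%E.

(* The rate u_j(t) at which the state [mu] serves class j. *)
Definition outflow (gamma : service_rates) mu (j : J) : R :=
  \int[mu]_x class_rate gamma j x.

Definition inflow (p : J -> J -> R) (gamma : service_rates) (lambda : J -> R)
    mu (j : J) : R :=
  lambda j + \sum_(i : J) p i j * outflow gamma mu i.

(* The mass at y of the signed measure
   sum_r gamma(x,r) (delta_(x minus r) - delta_x)
     + sum_j v_j (delta_(x plus j) - delta_x). *)
Definition jump (gamma : service_rates) v x y : R :=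
  \sum_(r < size x)
     gamma x r * ((delete_at x r == y)%:R - (x == y)%:R)
  + \sum_(j : J) v j * ((rcons x j == y)%:R - (x == y)%:R).

Definition nlmp_rhs (p : J -> J -> R) (gamma : service_rates)
    (lambda : J -> R) mu y : R :=
  \int[mu]_x jump gamma (inflow p gamma lambda mu) x y.

(* The evolution equation holds at every word y and every t >= 0, with a right
   derivative at t = 0; values of [mu] at negative times are irrelevant. *)
Definition nlmp_solution (p : J -> J -> R) (gamma : service_rates)
    (lambda : J -> R) (mu : R -> probability (word J) R) : Prop :=
  (forall (t : R) y, 0 < t ->
     is_derive t 1 (fun s : R => mass (mu s) y)
       (nlmp_rhs p gamma lambda (mu t) y)) /\
  (forall y,
     (fun h : R => (mass (mu h) y - mass (mu 0) y) / h : R) @ (0 : R)^'+ -->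
       nlmp_rhs p gamma lambda (mu 0) y).

Definition stationary (p : J -> J -> R) (gamma : service_rates)
    (lambda : J -> R) mu : Prop :=
  nlmp_solution p gamma lambda (fun _ : R => mu).

End nlmp.

(* Main.v *)
From HB Require Import structures.
Require Import Defs.
From mathcomp Require Import all_boot all_order all_algebra.
From mathcomp Require Import complex.
From mathcomp Require Import all_classical all_reals all_analysis.
From mathcomp Require Import ring lra zify.
From mathcomp Require finmap.
Set Implicit Arguments.
Unset Strict Implicit.
Unset Printing Implicit Defensive.
Import Order.TTheory GRing.Theory Num.Theory.
Import numFieldNormedType.Exports.
Local Open Scope classical_set_scope.
Local Open Scope ring_scope.

(** Let [w = (I - P)^-1 1], so that [w = 1 + P w] and a class-i customer carries
    the expected number [w i] of services it still generates.  The weight [h] of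
    a queue is the sum of the [w i] of its customers; the closed network consumes
    [h] at rate exactly [gamma x], and the arrivals feed it at rate
    [lambda . w].  In a stationary state this forces the inflow, and then
    [nu(h)], to be of the order of [lambda].

    For a trajectory [mu] and a stationary [nu], the distance
    [sum_x h x * |mu x - nu x|] decreases: services consume
    [w] per discrepant customer, the excess inflow they cause restores only
    [P w = w - 1], and every other contribution carries a factor [nu(h)] or
    [v^nu . w], hence is absorbed when [lambda] is small.  The dissipation is
    therefore at least a multiple of [sum_(x <> [::]) |mu x - nu x|], which gives
    uniqueness, and convergence by a Barbalat argument.  Since [h] is unbounded it
    is replaced by the finitely supported tent [min(h, 2K - h)^+], whose slope is
    at most 1, and the first moment of [mu] grows at most linearly in time.

    Existence is a linear problem: if [v] solves [v = lambda + v P], the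
    invariant measure of the chain with fixed inflow [v], obtained as the
    occupation measure of one excursion from the empty queue, has outflow [v]. *)

(** * Sums over the countable space of words *)

Section word_sums.
Context (R : realType) (J : finType).
Implicit Types (f g : word J -> R) (m : {measure set (word J) -> \bar R}).
Implicit Types (mu : probability (word J) R).

Definition summable_word f :=
  (@counting (word J) R).-integrable setT (EFin \o f).

(* Junk unless [f] is summable: [fine] sends infinite integrals to 0. *)
Definition sum_word f : R := \int[@counting (word J) R]_x f x.

Let pickle_word_invK := @pickle_invK (word J).

Lemma integral_word1 m (F : word J -> \bar R) x :
  (forall x, 0 <= F x)%E ->
  (\int[m]_(y in [set x]) F y = F x * m [set x])%E.
Proof.
move=> F0; rewrite (eq_integral (cst (F x))).
  by rewrite integral_cst.
by move=> y; rewrite inE => ->.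
Qed.

(** The codes [pickle_inv n] split the space into countably many pieces, each a singleton or empty,
    so countable additivity turns the integral into a series. *)
Lemma ge0_integral_word m (F : word J -> \bar R) :
  (forall x, 0 <= F x)%E ->
  (\int[m]_x F x =
   \sum_(n <oo) oapp (fun x => F x * m [set x]) 0 (pickle_inv n))%E.
Proof.
move=> F0.
pose S n : set (word J) := [set x | pickle_inv n = Some x].
have -> : [set: word J] = \bigcup_n S n.
  apply/seteqP; split=> // x _; exists (pickle x) => //=.
  by rewrite /S /= pickleK_inv.
rewrite ge0_integral_bigcup//; last first.
  by move=> i j _ _ [x [/= ix jx]]; rewrite -(pickle_word_invK i) -(pickle_word_invK j) ix jx.
apply: eq_eseriesr => n _; rewrite /S.
case: (pickle_inv n) => [x|] /=.
  rewrite (_ : [set _ | _] = [set x]) ?integral_word1//.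
  by apply/seteqP; split=> y /= => [[]|->].
by rewrite (_ : [set _ | _] = set0) ?integral_set0//; apply/seteqP; split.
Qed.

Lemma counting1 (x : word J) : @counting (word J) R [set x] = 1%E.
Proof.
rewrite /counting asboolT; last exact: finite_set1.
by rewrite fset_set1 finmap.cardfs1.
Qed.

Lemma massE mu x : (mass mu x)%:E = mu [set x].
Proof. by rewrite /mass fineK// fin_num_measure. Qed.

Lemma mass_ge0 mu x : 0 <= mass mu x.
Proof. by rewrite /mass fine_ge0. Qed.

Lemma ge0_integral_mass mu (F : word J -> \bar R) : (forall x, 0 <= F x)%E ->
  (\int[mu]_x F x = \int[@counting (word J) R]_x ((mass mu x)%:E * F x))%E.
Proof.
move=> F0; rewrite !ge0_integral_word//; last first.
  by move=> x; rewrite mule_ge0// lee_fin mass_ge0.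
apply: eq_eseriesr => n _; case: (pickle_inv n) => //= x.
by rewrite [counting _]counting1 mule1 massE muleC.
Qed.

(** Multiplication by the nonnegative [mass mu x] commutes with taking positive and negative parts,
    so the nonnegative case applies to each part. *)
Lemma integral_mass mu f :
  (\int[mu]_x (f x)%:E = \int[@counting (word J) R]_x (mass mu x * f x)%:E)%E.
Proof.
rewrite integralE [RHS]integralE !ge0_integral_mass//.
congr (_ - _)%E; apply: eq_integral => x _.
  rewrite !funeposE -EFin_max -EFinM maxr_pMr ?mass_ge0// mulr0 EFin_max//.
rewrite !funenegE -!EFinN -EFin_max -EFinM maxr_pMr ?mass_ge0// mulr0 mulrN EFin_max//.
Qed.

Lemma Rintegral_mass mu f : \int[mu]_x f x = sum_word (fun x => mass mu x * f x).
Proof. by rewrite /sum_word /Rintegral integral_mass. Qed.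

Lemma summable_mass mu : summable_word (mass mu).
Proof.
apply/integrableP; split => //.
have := ge0_integral_mass mu (fun=> lee01).
rewrite integral_cst//= probability_setT mul1e.
under eq_integral do rewrite mule1.
move=> e1; rewrite (eq_integral (fun x => (mass mu x)%:E)) -?e1 ?ltry// => x _.
by rewrite /= ger0_norm ?mass_ge0.
Qed.

Lemma sum_mass mu : sum_word (mass mu) = 1.
Proof.
transitivity (\int[mu]_x 1); last by rewrite Rintegral_cst// [_ [set: _]]probability_setT mul1r.
by rewrite Rintegral_mass; congr sum_word; apply/funext => x; rewrite mulr1.
Qed.

Lemma summable_le f g : summable_word g -> (forall x, `|f x| <= `|g x|) ->
  summable_word f.
Proof. by move=> ig fg; apply: le_integrable ig => // x _ /=; rewrite lee_fin. Qed.

Lemma summable_wordD f g : summable_word f -> summable_word g ->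
  summable_word (fun x => f x + g x).
Proof. by move=> sf sg; exact: (integrableD _ sf sg). Qed.

Lemma summable_wordZ c f : summable_word f -> summable_word (fun x => c * f x).
Proof. by move=> sf; exact: (integrableZl _ _ sf). Qed.

Lemma summable_wordN f : summable_word f -> summable_word (fun x => - f x).
Proof. by move=> sf; exact: (integrableN sf). Qed.

Lemma summable_wordB f g : summable_word f -> summable_word g ->
  summable_word (fun x => f x - g x).
Proof. by move=> sf sg; exact: (integrableB _ sf sg). Qed.

Lemma summable_norm f : summable_word f -> summable_word (fun x => `|f x|).
Proof. by move=> sf; apply: summable_le sf _ => x; rewrite normr_id. Qed.

Lemma summable_wordM f g C : summable_word f -> (forall x, `|g x| <= C) ->
  summable_word (fun x => f x * g x).
Proof.
move=> sf gC; apply: summable_le (summable_wordZ C sf) _ => x.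
rewrite !normrM mulrC ler_wpM2r// (le_trans (gC x))// ler_norm//.
Qed.

Lemma summable0 : summable_word (fun=> 0).
Proof. exact: integrable0. Qed.

Lemma summable_sum I (r : seq I) (P : pred I) (F : I -> word J -> R) :
  (forall i, P i -> summable_word (F i)) ->
  summable_word (fun x => \sum_(i <- r | P i) F i x).
Proof.
move=> sF; elim: r => [|i r IH].
  by under [fun x => _]funext do rewrite big_nil; exact: summable0.
under [fun x => _]funext do rewrite big_cons.
by have [Pi|//] := boolP (P i); apply: summable_wordD => //; exact: sF.
Qed.

Lemma sum_wordD f g : summable_word f -> summable_word g ->
  sum_word (fun x => f x + g x) = sum_word f + sum_word g.
Proof. by move=> sf sg; exact: RintegralD. Qed.

Lemma sum_wordB f g : summable_word f -> summable_word g ->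
  sum_word (fun x => f x - g x) = sum_word f - sum_word g.
Proof. by move=> sf sg; exact: RintegralB. Qed.

Lemma sum_wordZ c f : summable_word f ->
  sum_word (fun x => c * f x) = c * sum_word f.
Proof. by move=> sf; exact: RintegralZl. Qed.

Lemma sum_word0 : sum_word (fun=> 0) = 0.
Proof. by rewrite /sum_word Rintegral_cst// mul0r. Qed.

Lemma sum_word_sum I (r : seq I) (P : pred I) (F : I -> word J -> R) :
  (forall i, P i -> summable_word (F i)) ->
  sum_word (fun x => \sum_(i <- r | P i) F i x) =
  \sum_(i <- r | P i) sum_word (F i).
Proof.
move=> sF; elim: r => [|i r IH].
  by rewrite big_nil; under [fun x => _]funext do rewrite big_nil; exact: sum_word0.
rewrite big_cons; under [fun x => _]funext do rewrite big_cons.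
have [Pi|//] := boolP (P i); rewrite sum_wordD ?IH//; first exact: sF.
exact: summable_sum.
Qed.

Lemma le_sum_word f g : summable_word f -> summable_word g ->
  (forall x, f x <= g x) -> sum_word f <= sum_word g.
Proof. by move=> sf sg fg; exact: le_Rintegral. Qed.

Lemma sum_word_ge0 f : (forall x, 0 <= f x) -> 0 <= sum_word f.
Proof. by move=> f0; exact: Rintegral_ge0. Qed.

Lemma norm_sum_word f : summable_word f ->
  `|sum_word f| <= sum_word (fun x => `|f x|).
Proof. by move=> sf; exact: le_normr_Rintegral. Qed.

Lemma summable_point c y : summable_word (fun x => c * (x == y)%:R).
Proof.
apply: summable_wordZ; apply/integrableP; split => //.
rewrite ge0_integral_word//.
rewrite (eq_eseriesr (g := fun n => (n == pickle y)%:R%:E)); last first.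
  move=> n _; case E : (pickle_inv n) => [x|] /=.
    rewrite [X in (_ * X)%E]counting1 mule1 normr_nat; congr (nat_of_bool _)%:R%:E.
    by rewrite -[n](pickle_word_invK n) E /=; apply/eqP/eqP => [->//|/(pcan_inj pickleK)].
  case: eqP => //  ny.
  by move: E; rewrite ny pickleK_inv.
rewrite (nneseries_split 0 (pickle y).+1)//= add0n.
rewrite eseries0; last first.
  by move=> k; rewrite /= => yk _; rewrite gtn_eqF//.
rewrite adde0 sumEFin ltry//.
Qed.

Lemma sum_word_point c y : sum_word (fun x => c * (x == y)%:R) = c.
Proof.
rewrite sum_wordZ; last by under eq_fun do rewrite -[_%:R]mul1r; exact: summable_point.
rewrite -[RHS]mulr1; congr (_ * _).
transitivity (\int[@counting (word J) R]_x \1_[set y] x).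
  apply: eq_Rintegral => x _; rewrite indicE; congr (nat_of_bool _)%:R.
  by apply/eqP/idP; rewrite inE.
by rewrite /Rintegral integral_indic// setIT [X in fine X]counting1.
Qed.

Lemma finite_support_word f (s : seq (word J)) : uniq s ->
  (forall x, x \notin s -> f x = 0) ->
  f = (fun x => \sum_(y <- s) f y * (x == y)%:R).
Proof.
move=> us fs; apply/funext => x; have [xs|xs] := boolP (x \in s).
  rewrite (bigD1_seq x)//= eqxx mulr1 big1 ?addr0// => y yx.
  by rewrite eq_sym (negbTE yx) mulr0.
rewrite fs// big_seq big1// => y ys; case: eqP => [xy|]; last by rewrite mulr0.
by move: xs; rewrite xy ys.
Qed.

Lemma summable_finite f (s : seq (word J)) : uniq s ->
  (forall x, x \notin s -> f x = 0) -> summable_word f.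
Proof.
move=> us fs; rewrite (finite_support_word us fs).
by apply: summable_sum => y _; exact: summable_point.
Qed.

Lemma sum_word_finite f (s : seq (word J)) : uniq s ->
  (forall x, x \notin s -> f x = 0) -> sum_word f = \sum_(x <- s) f x.
Proof.
move=> us fs; rewrite {1}(finite_support_word us fs) sum_word_sum => [|y _].
  by apply: eq_bigr => y _; exact: sum_word_point.
exact: summable_point.
Qed.

Lemma le_sum_word_point f x : summable_word f -> (forall y, 0 <= f y) ->
  f x <= sum_word f.
Proof.
move=> sf f0; rewrite -{1}(sum_word_point (f x) x).
apply: le_sum_word => //; first exact: summable_point.
by move=> y; case: eqP => [->|_]; rewrite ?mulr1 ?mulr0.
Qed.

Lemma sum_seq_le_sum_word f (s : seq (word J)) : uniq s -> summable_word f ->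
  (forall x, 0 <= f x) -> \sum_(x <- s) f x <= sum_word f.
Proof.
move=> us sf f0; pose g x := if x \in s then f x else 0.
have gs x : x \notin s -> g x = 0 by rewrite /g => /negbTE ->.
rewrite (_ : \sum_(x <- s) f x = sum_word g).
  apply: le_sum_word => //; first exact: summable_finite gs.
  by move=> x; rewrite /g; case: ifP.
rewrite (sum_word_finite us gs) big_seq [RHS]big_seq.
by apply: eq_bigr => x xs; rewrite /g xs.
Qed.

(** A partial sum of the series in [ge0_integral_word] runs over the words with code below N, a
    duplicate-free list, so the bound on finite sums passes to the integral. *)
Lemma summable_bounded f B : (forall x, 0 <= f x) ->
  (forall s : seq (word J), uniq s -> \sum_(x <- s) f x <= B) ->
  summable_word f /\ sum_word f <= B.
Proof.
move=> f0 fB.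
have fleB : (\int[@counting (word J) R]_x (f x)%:E <= B%:E)%E.
  rewrite ge0_integral_word//.
  apply: lime_le.
    by apply: is_cvg_nneseries => n _ _; case: (pickle_inv n) => //= x; rewrite mule_ge0 ?lee_fin.
  apply: nearW => N.
  rewrite (eq_bigr (fun n => (oapp f 0 (pickle_inv n))%:E)); last first.
    move=> n _; case: (pickle_inv n) => //= x.
    by rewrite [counting _]counting1 mule1.
  rewrite sumEFin lee_fin.
  have -> : \sum_(0 <= n < N) oapp f 0 (pickle_inv n) =
      \sum_(x <- pmap (@pickle_inv (word J)) (index_iota 0 N)) f x.
    elim: (index_iota 0 N) => [|n s IH] /=; first by rewrite !big_nil.
    rewrite big_cons IH; case: (pickle_inv n) => [x|] /=; first by rewrite big_cons.
    by rewrite add0r.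
  apply: fB; apply: (pmap_uniq (g := pickle)); first exact: pickle_word_invK.
  exact: iota_uniq.
have sf : summable_word f.
  apply/integrableP; split => //; apply: le_lt_trans (ltry B).
  by apply: le_trans fleB; under eq_integral do rewrite /= ger0_norm//.
split => //; rewrite -lee_fin /sum_word /Rintegral fineK//.
exact: (integrable_fin_num _ sf).
Qed.

Lemma cvg_sum_word (F : nat -> word J -> R) f g : summable_word g ->
  (forall n x, `|F n x| <= g x) ->
  (forall x, F ^~ x @ \oo --> f x) ->
  sum_word (F n) @[n --> \oo] --> sum_word f.
Proof.
move=> sg Fg Ff.
have [] := @dominated_convergence _ _ _ (@counting (word J) R) setT measurableT
  (fun n x => (F n x)%:E) (fun x => (f x)%:E) (EFin \o g) => //.
- by apply: aeW => x _; apply: cvg_EFin; [exact: nearW|exact: Ff].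
- by apply: aeW => x n _ /=; rewrite lee_fin.
move=> sf _ cvg.
apply: fine_cvg; move: cvg; rewrite /sum_word /Rintegral fineK//.
exact: (integrable_fin_num _ sf).
Qed.

End word_sums.

(** * The generator on test functions *)

(** Supplies the finite supports of the truncated test functions used throughout. *)
Lemma words_of_bounded_size (J : finType) (K : nat) :
  exists2 s : seq (word J), uniq s & forall x : word J, (size x <= K)%N -> x \in s.
Proof.
suff [s sK] : exists s : seq (word J), forall x : word J, (size x <= K)%N -> x \in s.
  by exists (undup s) => [|x /sK]; rewrite ?undup_uniq// mem_undup.
elim: K => [|K [s IH]].
  by exists [:: [::]] => x; rewrite leqn0 => /nilP ->; rewrite mem_head.
exists ([::] :: [seq (i :: x : word J) | i <- enum J, x <- s]) => -[|i x] /= xK.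
  by rewrite mem_head.
by rewrite inE /=; apply/allpairsP; exists (i, x); split; rewrite //= ?mem_enum ?IH.
Qed.

Section generator.
Context (R : realType) (J : finType) (gamma : service_rates R J).
Implicit Types (x y : word J) (v w : J -> R) (phi : word J -> R).
Implicit Types (mu : probability (word J) R).

(** The Markov generator of one queue whose inflow rates are frozen at [v]; [jump] is its kernel,
    recovered at point indicators. *)
Definition generator v phi x : R :=
  \sum_(r < size x) gamma r * (phi (delete_at x r) - phi x)
  + \sum_(j : J) v j * (phi (rcons x j) - phi x).

(** Depending on [w], this additive functional is the weight h, the length of the queue, or its
    number of customers of one class. *)
Definition weight w x : R := \sum_(i <- x) w i.

Definition letter x (r : 'I_(size x)) : J := tnth (in_tuple x) r.

Definition served (c : J -> R) x : R := \sum_(r < size x) gamma r * c (letter r).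

Lemma jumpE v x y : jump gamma v x y = generator v (fun z => (z == y)%:R) x.
Proof. by []. Qed.

Lemma generator_finite v phi (s : seq (word J)) x : uniq s ->
  (forall y, y \notin s -> phi y = 0) ->
  \sum_(y <- s) phi y * jump gamma v x y = generator v phi x.
Proof.
move=> us sphi.
have pt z : \sum_(y <- s) phi y * (z == y)%:R = phi z.
  exact/esym/(congr1 (fun f => f z) (finite_support_word us sphi)).
rewrite /generator /jump; under eq_bigr do rewrite mulrDr.
rewrite big_split/=; congr (_ + _).
  under eq_bigr do rewrite mulr_sumr.
  rewrite exchange_big/=; apply: eq_bigr => r _.
  rewrite -(pt (delete_at x r)) -(pt x) -sumrB mulr_sumr.
  by apply: eq_bigr => y _; rewrite mulrCA mulrBr.
under eq_bigr do rewrite mulr_sumr.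
rewrite exchange_big/=; apply: eq_bigr => j _.
rewrite -(pt (rcons x j)) -(pt x) -sumrB mulr_sumr.
by apply: eq_bigr => y _; rewrite mulrCA mulrBr.
Qed.

Lemma generatorB v phi psi x :
  generator v (fun y => phi y - psi y) x = generator v phi x - generator v psi x.
Proof.
rewrite /generator.
rewrite (eq_bigr (fun r : 'I_(size x) => gamma r * (phi (delete_at x r) - phi x)
  - gamma r * (psi (delete_at x r) - psi x))); last by move=> r _; ring.
rewrite (eq_bigr (fun j => v j * (phi (rcons x j) - phi x)
  - v j * (psi (rcons x j) - psi x))); last by move=> j _; ring.
by rewrite !sumrB; ring.
Qed.

Lemma generator_cst v c x : generator v (fun=> c) x = 0.
Proof. by rewrite /generator !big1 ?addr0// => i _; rewrite subrr mulr0. Qed.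

Lemma size_delete_at x (r : 'I_(size x)) : size (delete_at x r) = (size x).-1.
Proof.
by rewrite /delete_at size_cat size_takel ?size_drop; have := ltn_ord r; lia.
Qed.

Lemma weight_rcons w x j : weight w (rcons x j) = weight w x + w j.
Proof. by rewrite /weight big_rcons/= addrC. Qed.

Lemma weight_delete_at w x (r : 'I_(size x)) :
  weight w (delete_at x r) = weight w x - w (letter r).
Proof.
(* The letter itself serves as default value for [nth]; it is never reached, since [r < size x]. *)
pose d := letter r; have dE : letter r = nth d x r by rewrite {1}/letter (tnth_nth d).
have -> : weight w x = weight w (take r x) + (w (nth d x r) + weight w (drop r.+1 x)).
  by rewrite /weight -{1}(cat_take_drop r x) big_cat/= (drop_nth d)// big_cons.
by rewrite dE /delete_at {1}/weight big_cat/= -!/(weight _ _); ring.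
Qed.

Lemma sum_class_rate (c : J -> R) x :
  \sum_j c j * class_rate gamma j x = served c x.
Proof.
rewrite /served (partition_big (fun r => letter r) predT)//=.
apply: eq_bigr => j _; rewrite /class_rate mulr_sumr; apply: eq_bigr => r /eqP <-.
by rewrite mulrC.
Qed.

Lemma served1 x : served (fun=> 1) x = total_rate gamma x.
Proof. by apply: eq_bigr => r _; rewrite mulr1. Qed.

Lemma servedB (c d : J -> R) x :
  served (fun j => c j - d j) x = served c x - served d x.
Proof. by rewrite /served -sumrB; apply: eq_bigr => r _; rewrite mulrBr. Qed.

Lemma generator_weight v w x :
  generator v (weight w) x = - served w x + \sum_j v j * w j.
Proof.
rewrite /generator /served -[X in _ = X + _]sumrN; congr (_ + _).
  by apply: eq_bigr => r _; rewrite weight_delete_at; ring.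
by apply: eq_bigr => j _; rewrite weight_rcons; ring.
Qed.

Lemma size_weight x : (size x)%:R = weight (fun=> 1) x.
Proof.
by rewrite /weight; elim: x => [|i x IH]; rewrite ?big_nil ?big_cons//= -IH mulrS.
Qed.

Lemma weight_le_size w C x : (forall j, w j <= C) -> weight w x <= C * (size x)%:R.
Proof.
move=> wC; rewrite size_weight /weight mulr_sumr; apply: ler_sum => i _.
by rewrite mulr1.
Qed.

Lemma size_le_weight w x : (forall j, 1 <= w j) -> (size x)%:R <= weight w x.
Proof. by move=> w1; rewrite size_weight; apply: ler_sum => i _. Qed.

Section bounded_rates.
Context (gp : R) (gamma_ge0 : forall x (r : 'I_(size x)), 0 <= gamma r).
Context (total_le : forall x, total_rate gamma x <= gp).

Lemma total_rate_ge0 x : 0 <= total_rate gamma x.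
Proof. by apply: sumr_ge0 => r _. Qed.

Lemma rate_bound_ge0 : 0 <= gp.
Proof. exact: le_trans (total_rate_ge0 [::]) (total_le _). Qed.

Lemma le_served (c d : J -> R) x : (forall j, c j <= d j) -> served c x <= served d x.
Proof. by move=> cd; apply: ler_sum => r _; rewrite ler_wpM2l. Qed.

Lemma served_cst c x : served (fun=> c) x = c * total_rate gamma x.
Proof. by rewrite /served /total_rate mulr_sumr; apply: eq_bigr => r _; rewrite mulrC. Qed.

Lemma norm_served (c : J -> R) C x : 0 <= C -> (forall j, `|c j| <= C) ->
  `|served c x| <= C * gp.
Proof.
move=> C0 cC; rewrite (le_trans (ler_norm_sum _ _ _))//.
rewrite (@le_trans _ _ (\sum_(r < size x) gamma r * C))//.
  by apply: ler_sum => r _; rewrite normrM ger0_norm// ler_wpM2l.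
by rewrite -mulr_suml mulrC ler_wpM2l// total_le.
Qed.

Lemma norm_generator v phi M x : (forall j, 0 <= v j) -> 0 <= M ->
  (forall r : 'I_(size x), `|phi (delete_at x r) - phi x| <= M) ->
  (forall j, `|phi (rcons x j) - phi x| <= M) ->
  `|generator v phi x| <= M * (gp + \sum_j v j).
Proof.
move=> v0 M0 Mdel Mrc; rewrite mulrDr (le_trans (ler_normD _ _))// lerD//.
  rewrite (le_trans (ler_norm_sum _ _ _))//.
  rewrite (@le_trans _ _ (\sum_(r < size x) gamma r * M))//.
    by apply: ler_sum => r _; rewrite normrM ger0_norm// ler_wpM2l.
  by rewrite -mulr_suml mulrC ler_wpM2l// total_le.
rewrite (le_trans (ler_norm_sum _ _ _))// mulr_sumr; apply: ler_sum => j _.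
by rewrite normrM ger0_norm// mulrC ler_wpM2r.
Qed.

Lemma sum_generator_finite (q : word J -> R) v phi (s : seq (word J)) :
  summable_word q -> (forall j, 0 <= v j) -> uniq s ->
  (forall y, y \notin s -> phi y = 0) ->
  sum_word (fun x => q x * generator v phi x) =
  \sum_(y <- s) phi y * sum_word (fun x => q x * jump gamma v x y).
Proof.
move=> sq v0 us sphi.
have sj y : summable_word (fun x => q x * jump gamma v x y).
  apply: (summable_wordM (C := 1 * (gp + \sum_j v j))) => // x.
  rewrite jumpE; apply: norm_generator => // [r|j];
    by do 2 case: (_ == _); rewrite ?subrr ?subr0 ?sub0r ?normrN ?normr1 ?normr0.
transitivity (sum_word (fun x => \sum_(y <- s) phi y * (q x * jump gamma v x y))).
  congr sum_word; apply/funext => x; rewrite -(generator_finite v x us sphi) mulr_sumr.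
  by apply: eq_bigr => y _; rewrite mulrCA.
rewrite sum_word_sum => [|y _]; last exact: summable_wordZ.
by apply: eq_bigr => y _; rewrite sum_wordZ.
Qed.

(* [f] is cut off at sizes between K and 2K, where it is at most of order K, so
   the cut-off keeps the increments bounded uniformly in K. *)
Lemma sum_generator_lipschitz (q : word J -> R) v (f : word J -> R) M :
  summable_word q -> (forall j, 0 <= v j) ->
  (forall y, y != [::] -> sum_word (fun x => q x * jump gamma v x y) = 0) ->
  0 <= M ->
  (forall x (r : 'I_(size x)), `|f (delete_at x r) - f x| <= M) ->
  (forall x j, `|f (rcons x j) - f x| <= M) ->
  sum_word (fun x => q x * generator v f x) = 0.
Proof.
move=> sq v0 qj M0.
(* [qj] gives the balance at nonempty words, so the test function should vanish at the empty one;
   subtracting a constant, which the generator kills, arranges this. *)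
wlog f0 : f / f [::] = 0 => [main fdel frc|fdel frc].
  rewrite -(main (fun x => f x - f [::])) ?subrr//.
  - by congr sum_word; apply/funext => x; rewrite generatorB generator_cst subr0.
  - by move=> x r; rewrite (le_trans _ (fdel x r))// opprB addrA subrK.
  - by move=> x j; rewrite (le_trans _ (frc x j))// opprB addrA subrK.
have fM x : `|f x| <= M * (size x)%:R.
  elim/last_ind: x => [|x j IH]; first by rewrite f0 normr0 mulr0.
  rewrite size_rcons -natr1 mulrDr mulr1 -[f _](subrK (f x)).
  by rewrite addrC (le_trans (ler_normD _ _))// lerD.
(* With truncated subtraction, [m K x / K.+1] is 1 up to size K+1, falls linearly to 0 at size 2K+2
   and stays 0 beyond. *)
pose m K x := minn K.+1 (2 * K.+1 - size x).
pose F K x := f x * ((m K x)%:R / K.+1%:R).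
(* One [M] comes from the increment of [f]. The cut-off moves by at most 1/(K+1) where [|f x|] is at
   most M(2K+2), which adds [2 * M]; at larger sizes it vanishes at both words. *)
have Finc K x x' : `|f x' - f x| <= M -> (size x <= (size x').+1)%N ->
    (size x' <= (size x).+1)%N -> `|F K x' - F K x| <= 3 * M.
  move=> ff xx' x'x; pose k : R := K.+1%:R; have k0 : 0 < k by rewrite ltr0n.
  have -> : F K x' - F K x =
      (f x' - f x) * ((m K x')%:R / k) + f x * (((m K x')%:R - (m K x)%:R) / k).
    by rewrite /F -/k; field; rewrite gt_eqF.
  rewrite (le_trans (ler_normD _ _))// (_ : 3 * M = M + 2 * M); last by ring.
  rewrite !normrM lerD//.
    rewrite -[leRHS]mulr1 ler_pM//.
    by rewrite -normrM ger0_norm ?divr_ge0// ler_pdivrMr// mul1r ler_nat geq_minl.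
  have [xK|xK] := leqP (size x) (2 * K.+1).
    rewrite normfV (gtr0_norm k0) mulrA ler_pdivrMr//.
    rewrite (@le_trans _ _ (M * (2 * K.+1)%:R * 1))//; last first.
      by rewrite mulr1 natrM /k; lra.
    rewrite ler_pM//; first by rewrite (le_trans (fM x))// ler_wpM2l// ler_nat.
    rewrite distrC /m; have [a b] : (m K x <= (m K x').+1)%N /\ (m K x' <= (m K x).+1)%N.
      by rewrite /m; lia.
    rewrite ler_norml; move: a b; rewrite -!(ler_nat R) -!natr1 /m; lra.
  have -> : m K x = 0%N by rewrite /m; lia.
  have -> : m K x' = 0%N by rewrite /m; lia.
  by rewrite subrr normr0 mul0r mulr0 mulr_ge0.
have main K : sum_word (fun x => q x * generator v (F K) x) = 0.
  have [s us sK] := words_of_bounded_size J (2 * K.+1).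
  rewrite (sum_generator_finite sq v0 us) => [|y ys].
    rewrite big1 // => -[|i y] _; first by rewrite /F f0 !mul0r.
    by rewrite qj ?mulr0.
  have := contraNN (sK y) ys; rewrite -ltnNge => yK.
  by rewrite /F (_ : m K y = 0%N) ?mul0r ?mulr0// /m; lia.
suff : sum_word (fun x => q x * generator v (F n) x) @[n --> \oo] -->
    sum_word (fun x => q x * generator v f x).
  under eq_fun do rewrite main.
  by move=> /cvg_lim <- //; rewrite lim_cst.
apply: (@cvg_sum_word _ _ _ _ (fun x => `|q x| * (3 * M * (gp + \sum_j v j)))).
- apply: summable_wordM; first exact: summable_norm.
  by move=> x; exact: lexx.
- move=> n x; rewrite normrM ler_wpM2l//; apply: norm_generator => //.
  + by rewrite mulr_ge0.
  + by move=> r; apply: Finc => //; rewrite size_delete_at; lia.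
  + by move=> j; apply: Finc => //; rewrite size_rcons; lia.
- move=> x; apply: cvg_near_cst; exists (size x) => // K /= xK.
  have Ff y : (size y <= K.+1)%N -> F K y = f y.
    move=> yK; rewrite /F (_ : m K y = K.+1) ?divff ?mulr1 ?pnatr_eq0// /m; lia.
  rewrite /generator; congr (_ * (_ + _)); apply: eq_bigr => i _.
    by rewrite !Ff// ?size_delete_at; lia.
  by rewrite !Ff// ?size_rcons; lia.
Qed.

End bounded_rates.
End generator.

(** * Moments of stationary states *)

Lemma norm_minB (R : realDomainType) (a b c : R) :
  `|Num.min a c - Num.min b c| <= `|a - b|.
Proof.
have := ler_norm (a - b); have := ler_norm (b - a); rewrite distrC ler_norml.
by case: (leP a c); case: (leP b c) => *; apply/andP; split; lra.
Qed.

Section estimates.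
Context (R : realType) (J : finType) (p : J -> J -> R) (gamma : service_rates R J).
Context (gm gp : R).
Context (p_ge0 : forall i j : J, 0 <= p i j).
Context (gamma_ge0 : forall x (r : 'I_(size x)), 0 <= gamma r).
Context (gm_gt0 : 0 < gm).
Context (gm_le : forall x : word J, x != [::] -> gm <= total_rate gamma x).
Context (gp_ge : forall x : word J, total_rate gamma x <= gp).
Context (w : J -> R) (W : R).
Context (w_ge1 : forall j, 1 <= w j) (w_le : forall j, w j <= W).
Context (w_eq : forall i, w i = 1 + \sum_j p i j * w j).
Context (W_ge1 : 1 <= W).
Implicit Types (mu nu : probability (word J) R) (x y : word J).

Let gp_ge0 : 0 <= gp := rate_bound_ge0 gamma_ge0 gp_ge.
Let w_ge0 j : 0 <= w j. Proof. exact: le_trans (w_ge1 j). Qed.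
Let W_ge0 : 0 <= W. Proof. exact: le_trans W_ge1. Qed.

Definition busy x : R := (x != [::])%:R.

Lemma total_rate_ge_busy x : gm * busy x <= total_rate gamma x.
Proof.
rewrite /busy; case: eqP => [->|/eqP x0] /=.
  by rewrite mulr0 total_rate_ge0.
by rewrite mulr1 gm_le.
Qed.

Lemma served_le_total (c : J -> R) C x : (forall j, c j <= C) ->
  served gamma c x <= C * total_rate gamma x.
Proof.
move=> cC; rewrite -served_cst; apply: le_served => //.
Qed.

Lemma total_rate_le_served x : total_rate gamma x <= served gamma w x.
Proof. by rewrite -served1; apply: le_served. Qed.

Lemma norm_class_rate j x : `|class_rate gamma j x| <= gp.
Proof.
rewrite ger0_norm; last exact: sumr_ge0.
apply: le_trans (gp_ge x).
by rewrite [leRHS](bigID (fun r => tnth (in_tuple x) r == j))/= lerDl sumr_ge0.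
Qed.

Lemma class_rate_ge0 j x : 0 <= class_rate gamma j x.
Proof. exact: sumr_ge0. Qed.

Lemma norm_total_rate x : `|total_rate gamma x| <= gp.
Proof. by rewrite ger0_norm// total_rate_ge0. Qed.

Lemma norm_served_w x : `|served gamma w x| <= W * gp.
Proof. by apply: norm_served => // j; rewrite ger0_norm. Qed.

Lemma outflowE mu j :
  outflow gamma mu j = sum_word (fun x => mass mu x * class_rate gamma j x).
Proof. exact: Rintegral_mass. Qed.

Lemma outflow_ge0 mu j : 0 <= outflow gamma mu j.
Proof.
by rewrite outflowE sum_word_ge0// => x; rewrite mulr_ge0 ?mass_ge0 ?class_rate_ge0.
Qed.

Lemma sum_served (q : word J -> R) c : summable_word q ->
  \sum_j c j * sum_word (fun x => q x * class_rate gamma j x) =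
  sum_word (fun x => q x * served gamma c x).
Proof.
move=> sq; have sj j : summable_word (fun x => q x * class_rate gamma j x).
  by apply: (summable_wordM (C := gp)) => // x; exact: norm_class_rate.
rewrite (eq_bigr (fun j => sum_word (fun x => c j * (q x * class_rate gamma j x)))).
  rewrite -sum_word_sum => [|j _]; last exact: summable_wordZ.
  congr sum_word; apply/funext => x; rewrite -sum_class_rate mulr_sumr.
  by apply: eq_bigr => j _; rewrite mulrCA.
by move=> j _; rewrite sum_wordZ.
Qed.

Lemma outflow_le mu j : outflow gamma mu j <= gp.
Proof.
rewrite outflowE -[leRHS]mulr1 -(sum_mass mu) -sum_wordZ; last exact: summable_mass.
have sm := summable_mass mu.
apply: le_sum_word => [||x]; [|exact: summable_wordZ|].
  by apply: (summable_wordM (C := gp)) => // x; exact: norm_class_rate.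
by rewrite mulrC ler_wpM2r ?mass_ge0// (le_trans (ler_norm _))// norm_class_rate.
Qed.

Lemma nlmp_rhsE lambda mu y : nlmp_rhs p gamma lambda mu y =
  sum_word (fun x => mass mu x * jump gamma (inflow p gamma lambda mu) x y).
Proof. exact: Rintegral_mass. Qed.

Section fixed_lambda.
Context (lambda : J -> R) (lambda_ge0 : forall j, 0 <= lambda j).

Let L := \sum_j lambda j * w j.

Lemma inflow_ge0 mu j : 0 <= inflow p gamma lambda mu j.
Proof. by rewrite addr_ge0// sumr_ge0// => i _; rewrite mulr_ge0// outflow_ge0. Qed.

Lemma inflow_le mu j : inflow p gamma lambda mu j <= lambda j + \sum_i p i j * gp.
Proof.
by rewrite lerD2l ler_sum// => i _; rewrite ler_wpM2l// outflow_le.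
Qed.

(** Since P w = w - 1, a class-i service removes weight [w i] and its routing returns [w i - 1] on
    average: each service costs one unit. *)
Lemma inflow_weight mu : \sum_j inflow p gamma lambda mu j * w j =
  L + sum_word (fun x => mass mu x * served gamma w x)
  - sum_word (fun x => mass mu x * total_rate gamma x).
Proof.
have sm := summable_mass mu.
under eq_bigr do rewrite mulrDl.
rewrite big_split/= -addrA; congr (_ + _).
under eq_bigr do rewrite mulr_suml.
rewrite exchange_big/= -sum_wordB; last 2 first.
- by apply: (summable_wordM (C := W * gp)) => // x; exact: norm_served_w.
- by apply: (summable_wordM (C := gp)) => // x; exact: norm_total_rate.
transitivity (\sum_i (w i - 1) * outflow gamma mu i).
  apply: eq_bigr => i _; rewrite [w i in RHS]w_eq addrAC subrr add0r mulr_suml.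
  by apply: eq_bigr => j _; rewrite mulrAC.
under eq_bigr do rewrite outflowE.
rewrite sum_served//; congr sum_word; apply/funext => x.
by rewrite -mulrBr (servedB gamma w (fun=> 1)) served1.
Qed.

Lemma summable_generator mu (v : J -> R) phi M : (forall j, 0 <= v j) -> 0 <= M ->
  (forall x, `|phi x| <= M) ->
  summable_word (fun x => mass mu x * generator gamma v phi x).
Proof.
move=> v0 M0 phiM; apply: (summable_wordM (C := (M + M) * (gp + \sum_j v j))).
  exact: summable_mass.
by move=> x; apply: norm_generator => // [|r|j];
  rewrite ?addr_ge0// (le_trans (ler_normB _ _))// lerD.
Qed.

Lemma rhs_generator mu phi (s : seq (word J)) : uniq s ->
  (forall y, y \notin s -> phi y = 0) ->
  \sum_(y <- s) phi y * nlmp_rhs p gamma lambda mu y =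
  sum_word (fun x => mass mu x * generator gamma (inflow p gamma lambda mu) phi x).
Proof.
move=> us sphi.
rewrite (sum_generator_finite gamma_ge0 gp_ge _ _ us sphi)//.
- by under eq_bigr do rewrite nlmp_rhsE.
- exact: summable_mass.
- exact: inflow_ge0.
Qed.

Definition balanced mu := forall y, nlmp_rhs p gamma lambda mu y = 0.

Lemma stationary_balanced mu : stationary p gamma lambda mu <-> balanced mu.
Proof.
split=> [[der _] y|mu0].
  have d1 := der 1 y ltr01.
  have d2 : is_derive (1 : R) 1 (fun=> mass mu y) (0 : R) by exact: is_derive_cst.
  by rewrite -(@derive_val _ _ _ _ _ _ _ d1) (@derive_val _ _ _ _ _ _ _ d2).
split=> [t y _|y]; rewrite mu0.
  exact: is_derive_cst.
rewrite (_ : (fun h : R => _) = cst 0); first exact: cvg_cst.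
by apply/funext => h; rewrite subrr mul0r.
Qed.

(** * Identities and moment bound for a balanced state *)

Section balanced_state.
Context (nu : probability (word J) R) (nu0 : balanced nu).
Let v := inflow p gamma lambda nu.

Lemma balanced_lipschitz f M : 0 <= M ->
  (forall x (r : 'I_(size x)), `|f (delete_at x r) - f x| <= M) ->
  (forall x j, `|f (rcons x j) - f x| <= M) ->
  sum_word (fun x => mass nu x * generator gamma v f x) = 0.
Proof.
move=> M0 fdel frc; apply: (sum_generator_lipschitz gamma_ge0 gp_ge _ _ _ M0) => //.
- exact: summable_mass.
- exact: inflow_ge0.
- by move=> y _; rewrite -nlmp_rhsE nu0.
Qed.

(** Tests the balance with h, whose increments are at most [W]: the served weight cancels against
    the feedback in [inflow_weight], leaving external input against one unit per service. *)
Lemma balanced_total_rate : sum_word (fun x => mass nu x * total_rate gamma x) = L.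
Proof.
have sm := summable_mass nu.
have := @balanced_lipschitz (weight w) W W_ge0.
under [in X in _ -> _ -> X]eq_fun do rewrite generator_weight mulrDr mulrN.
rewrite sum_wordD; last 2 first.
- apply: summable_wordN; apply: (summable_wordM (C := W * gp)) => // x; exact: norm_served_w.
- exact: (summable_wordM (C := `|\sum_j v j * w j|)).
under [X in sum_word X + _]eq_fun do rewrite -mulN1r.
rewrite sum_wordZ; last first.
  by apply: (summable_wordM (C := W * gp)) => // x; exact: norm_served_w.
under [X in _ + sum_word X]eq_fun do rewrite mulrC.
rewrite sum_wordZ// sum_mass inflow_weight.
move=> H; suff : -1 * sum_word (fun x => mass nu x * served gamma w x) +
  (L + sum_word (fun x => mass nu x * served gamma w x) -
    sum_word (fun x => mass nu x * total_rate gamma x)) * 1 = 0 by lra.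
apply: H => [x r|x j].
  by rewrite weight_delete_at addrAC subrr add0r normrN ger0_norm.
by rewrite weight_rcons addrAC subrr add0r ger0_norm.
Qed.

Lemma balanced_inflow : \sum_j v j * w j <= W * L.
Proof.
have sm := summable_mass nu.
have sT : summable_word (fun x => mass nu x * total_rate gamma x).
  by apply: (summable_wordM (C := gp)) => // x; exact: norm_total_rate.
rewrite inflow_weight balanced_total_rate addrAC subrr add0r.
rewrite -balanced_total_rate -sum_wordZ//.
apply: le_sum_word => [||x].
- by apply: (summable_wordM (C := W * gp)) => // x; exact: norm_served_w.
- exact: summable_wordZ.
- by rewrite mulrCA ler_wpM2l ?mass_ge0// served_le_total.
Qed.

(** Tests the balance with the square of [min(h, K)]. Below the level K its drift is at most - gm h
    plus terms of order [W ^+ 2], because a busy queue loses weight at rate at least [gm] and gains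
    it at rate at most [gm / 2]. The resulting bound does not depend on K. *)
Lemma balanced_moment : W * L <= gm / 2 ->
  summable_word (fun x => mass nu x * weight w x) /\
  sum_word (fun x => mass nu x * weight w x) <= 2 * W ^+ 2 * L / gm.
Proof.
move=> WL.
have sm := summable_mass nu.
have h0 x : 0 <= weight w x by exact: sumr_ge0.
have V : \sum_j v j * w j <= gm / 2 by exact: le_trans balanced_inflow _.
have sT : summable_word (fun x => mass nu x * total_rate gamma x).
  by apply: (summable_wordM (C := gp)) => // x; exact: norm_total_rate.
have main (K : R) : 0 <= K -> sum_word (fun x =>
    mass nu x * (if weight w x < K then weight w x else 0)) <= 2 * W ^+ 2 * L / gm.
  move=> K0; pose f x : R := Num.min (weight w x) K ^+ 2.
  have sq (a b c : R) : 0 <= a -> 0 <= b -> `|a - b| <= c ->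
      `|Num.min a K ^+ 2 - Num.min b K ^+ 2| <= c * (2 * K).
    move=> a0 b0 ab; rewrite subr_sqr normrM ler_pM//.
      exact: le_trans (norm_minB _ _ _) ab.
    rewrite ger0_norm ?addr_ge0 ?le_min ?a0 ?b0//.
    by rewrite mulr2n mulrDl mul1r lerD// ge_min lexx orbT.
  have f0 : sum_word (fun x => mass nu x * generator gamma v f x) = 0.
    apply: (@balanced_lipschitz _ (W * (2 * K))).
    - by rewrite !mulr_ge0.
    - move=> x r; apply: sq => //.
      by rewrite weight_delete_at addrAC subrr add0r normrN ger0_norm.
    - by move=> x j; apply: sq => //; rewrite weight_rcons addrAC subrr add0r ger0_norm.
  pose t x := if weight w x < K then weight w x else 0.
  have tK x : `|t x| <= K.
    by rewrite /t; case: ifP => xK; rewrite ger0_norm// ltW.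
  have bound x : generator gamma v f x <=
      - (gm * t x) + W ^+ 2 * total_rate gamma x + W ^+ 2 * L.
    have Wv : \sum_j v j * (w j ^+ 2) <= W ^+ 2 * L.
      apply: (@le_trans _ _ (W * \sum_j v j * w j)).
        rewrite mulr_sumr ler_sum// => j _.
        by rewrite expr2 mulrA mulrC ler_wpM2r// mulr_ge0// inflow_ge0.
      by rewrite expr2 -mulrA ler_wpM2l// balanced_inflow.
    have L0 : 0 <= L by apply: sumr_ge0 => j _; rewrite mulr_ge0.
    have rest : 0 <= W ^+ 2 * total_rate gamma x + W ^+ 2 * L.
      by rewrite addr_ge0// mulr_ge0 ?exprn_ge0// total_rate_ge0.
    (* At weight at least K the function [f] is at its maximum: services cannot raise it and
       arrivals leave it unchanged. *)
    rewrite /generator /t; case: ltP => xK; last first.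
      rewrite mulr0 oppr0 add0r; apply: le_trans rest.
      rewrite -[leRHS]addr0 lerD//.
        rewrite sumr_le0// => r _; rewrite mulr_ge0_le0// subr_le0.
        rewrite /f ler_pXn2r ?nnegrE ?le_min ?h0 ?K0//.
        by rewrite !ge_min xK lexx !orbT.
      rewrite big1// => j _; rewrite /f !(min_idPr _) ?subrr ?mulr0//.
      by rewrite weight_rcons (le_trans xK)// lerDl.
    have fx : f x = weight w x ^+ 2 by rewrite /f (min_idPl _)// ltW.
    have fle y : f y <= weight w y ^+ 2.
      by rewrite /f ler_pXn2r ?nnegrE ?le_min ?h0 ?K0// ge_min lexx.
    have A1 : \sum_(r < size x) gamma r * (f (delete_at x r) - f x) <=
        - (2 * weight w x * served gamma w x) + W ^+ 2 * total_rate gamma x.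
      apply: (@le_trans _ _ (\sum_(r < size x)
          gamma r * (- (2 * weight w x * w (letter r)) + W ^+ 2))); last first.
        rewrite (eq_bigr (fun r => - (2 * weight w x) * (gamma r * w (letter r))
          + W ^+ 2 * gamma r)); last by move=> r _; ring.
        by rewrite big_split/= -!mulr_sumr mulNr.
      apply: ler_sum => r _.
      rewrite ler_wpM2l// fx lerBlDr (le_trans (fle _))// weight_delete_at.
      have : w (letter r) ^+ 2 <= W ^+ 2 by rewrite ler_pXn2r ?nnegrE.
      by lra.
    have A2 : \sum_j v j * (f (rcons x j) - f x) <=
        2 * weight w x * (\sum_j v j * w j) + \sum_j v j * w j ^+ 2.
      apply: (@le_trans _ _ (\sum_j v j * (2 * weight w x * w j + w j ^+ 2))); last first.
        rewrite (eq_bigr (fun j => 2 * weight w x * (v j * w j) + v j * w j ^+ 2)).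
          by rewrite big_split/= -!mulr_sumr.
        by move=> j _; ring.
      apply: ler_sum => j _.
      rewrite ler_wpM2l ?inflow_ge0// fx lerBlDr (le_trans (fle _))// weight_rcons.
      by lra.
    have [xE|x0] := eqVneq x [::].
      have e0 : weight w x = 0 by rewrite xE /weight big_nil.
      by move: A1 A2; rewrite e0; lra.
    have A3 : gm <= served gamma w x by rewrite (le_trans (gm_le x0))// total_rate_le_served.
    (* The linear term of the quadratic drift is [- 2 * weight w x] times served weight minus
       arriving weight, and that difference is at least [gm / 2]. *)
    have : 0 <= weight w x * (served gamma w x - \sum_j v j * w j - gm / 2).
      by rewrite mulr_ge0//; lra.
    by lra.
  have st : summable_word (fun x => mass nu x * t x) by exact: summable_wordM tK.
  have : 0 <= - gm * sum_word (fun x => mass nu x * t x) + W ^+ 2 * L + W ^+ 2 * L.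
    rewrite -{1}f0 -{1}balanced_total_rate -!sum_wordZ//.
    rewrite -[W ^+ 2 * L]mulr1 -(sum_mass nu) -sum_wordZ//.
    have s1 : summable_word (fun x => - gm * (mass nu x * t x)) by exact: summable_wordZ.
    have s2 : summable_word (fun x => W ^+ 2 * (mass nu x * total_rate gamma x)).
      exact: summable_wordZ.
    have s3 : summable_word (fun x => W ^+ 2 * L * mass nu x) by exact: summable_wordZ.
    rewrite -!sum_wordD//; last exact: summable_wordD.
    apply: le_sum_word => [||x].
    - apply: (@summable_generator _ _ _ (K ^+ 2)) => // [j||x].
      + exact: inflow_ge0.
      + exact: exprn_ge0.
      + rewrite ger0_norm ?exprn_ge0 ?le_min ?h0//.
        by rewrite ler_pXn2r ?nnegrE ?le_min ?h0 ?K0// ge_min lexx orbT.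
    - by do 2 apply: summable_wordD => //.
    - have := ler_wpM2l (mass_ge0 nu x) (bound x); rewrite !mulrDr; lra.
  move=> H; rewrite ler_pdivlMr//; move: H; rewrite -/t; lra.
apply: summable_bounded => [x|s us]; first by rewrite mulr_ge0 ?mass_ge0.
(* This level exceeds the weight of every word of [s], so the truncation does not change the finite
   sum. *)
pose K := 1 + \sum_(x <- s) weight w x.
have K0 : 0 <= K by rewrite addr_ge0// sumr_ge0.
apply: le_trans (main K K0).
rewrite (_ : \sum_(x <- s) _ = \sum_(x <- s)
    mass nu x * (if weight w x < K then weight w x else 0)).
  apply: sum_seq_le_sum_word => // [|x].
    apply: (summable_wordM (C := K)) => // x.
    by case: ifP => xK; rewrite ger0_norm// ltW.
  by rewrite mulr_ge0 ?mass_ge0//; case: ifP.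
rewrite big_seq [RHS]big_seq; apply: eq_bigr => x xs.
rewrite ifT// /K (bigD1_seq x)//= addrCA ltr_pwDr//.
by rewrite ltr_pwDl// sumr_ge0.
Qed.

End balanced_state.
End fixed_lambda.
End estimates.

(** * The contraction estimate *)

Section contraction.
Context (R : realType) (J : finType) (p : J -> J -> R) (gamma : service_rates R J).
Context (gm gp : R).
Context (p_ge0 : forall i j : J, 0 <= p i j).
Context (p_le1 : forall i : J, \sum_(j : J) p i j <= 1).
Context (gamma_ge0 : forall x (r : 'I_(size x)), 0 <= gamma r).
Context (gm_le : forall x : word J, x != [::] -> gm <= total_rate gamma x).
Context (gp_ge : forall x : word J, total_rate gamma x <= gp).
Context (w : J -> R) (W : R).
Context (w_ge1 : forall j, 1 <= w j) (w_le : forall j, w j <= W).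
Context (w_eq : forall i, w i = 1 + \sum_j p i j * w j).
Context (W_ge1 : 1 <= W).
Context (lambda : J -> R) (lambda_ge0 : forall j, 0 <= lambda j).
Context (mu nu : probability (word J) R).

Let gp_ge0 : 0 <= gp := rate_bound_ge0 gamma_ge0 gp_ge.
Let w_ge0 j : 0 <= w j. Proof. exact: le_trans (w_ge1 j). Qed.
Let W_ge0 : 0 <= W. Proof. exact: le_trans W_ge1. Qed.
Let h0 x : 0 <= weight w x. Proof. exact: sumr_ge0. Qed.

Definition gap x : R := `|mass mu x - mass nu x|.

(** The empty queue serves nobody, so services dissipate only the discrepancy at nonempty words. *)
Definition busy_gap : R := sum_word (fun x : word J => busy R x * gap x).

Let va := inflow p gamma lambda mu.
Let vb := inflow p gamma lambda nu.
Let d j := va j - vb j.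

Lemma gap_ge0 x : 0 <= gap x. Proof. by rewrite /gap. Qed.

Let sa : summable_word (mass mu) := summable_mass mu.
Let sb : summable_word (mass nu) := summable_mass nu.
Let sd : summable_word (fun x => mass mu x - mass nu x) := summable_wordB sa sb.

Lemma summable_gap : summable_word gap.
Proof. exact: summable_norm. Qed.

Lemma norm_busy (x : word J) : `|busy R x| <= 1.
Proof. by rewrite /busy; case: (_ != _); rewrite ?normr1 ?normr0. Qed.

Lemma summable_busy_gap : summable_word (fun x : word J => busy R x * gap x).
Proof.
under eq_fun do rewrite mulrC.
apply: (summable_wordM (C := 1)); [exact: summable_gap|exact: norm_busy].
Qed.

(** Both measures have total mass 1, so the signed discrepancy at the empty word is minus the sum of
    all the others. *)
Lemma gap_nil : gap [::] <= busy_gap.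
Proof.
have sp : summable_word (fun x : word J =>
    (mass mu [::] - mass nu [::]) * (x == [::])%:R) by exact: summable_point.
rewrite /gap -normrN -(sum_word_point (mass mu [::] - mass nu [::]) ([::] : word J)).
have e : sum_word (fun x => mass mu x - mass nu x) = 0.
  by rewrite sum_wordB// !sum_mass subrr.
rewrite -[X in `|X|]add0r -e -sum_wordB//.
apply: le_trans (norm_sum_word (summable_wordB sd sp)) _.
apply: le_sum_word => [||x].
- by apply: summable_norm; exact: summable_wordB.
- exact: summable_busy_gap.
- by rewrite /busy; case: eqP => [->|_] /=; rewrite ?mulr1 ?subrr ?normr0 ?mul0r// mulr0 subr0 mul1r.
Qed.

Lemma gap_le x : gap x <= busy_gap.
Proof.
have [->|x0] := eqVneq x [::]; first exact: gap_nil.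
rewrite (_ : gap x = busy R x * gap x); last by rewrite /busy x0 mul1r.
apply: (le_sum_word_point (f := fun x => busy R x * gap x)) => [|y].
  exact: summable_busy_gap.
by rewrite mulr_ge0 ?gap_ge0.
Qed.

Lemma sum_gap_le : sum_word gap <= 2 * busy_gap.
Proof.
have sp : summable_word (fun x : word J => gap [::] * (x == [::])%:R).
  exact: summable_point.
rewrite (_ : 2 * _ = busy_gap + busy_gap); last by ring.
apply: le_trans (lerD (lexx busy_gap) gap_nil).
rewrite -(sum_word_point (gap [::]) ([::] : word J)) -sum_wordD//; last exact: summable_busy_gap.
apply: le_sum_word => [||x]; first exact: summable_gap.
  by apply: summable_wordD => //; exact: summable_busy_gap.
by rewrite /busy; case: eqP => [->|_] /=; rewrite ?mulr1 ?mul0r ?add0r// mulr0 mul1r addr0.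
Qed.

Lemma summable_gap_bounded f C : (forall x, `|f x| <= C) ->
  summable_word (fun x => gap x * f x).
Proof. by move=> fC; apply: summable_wordM fC; exact: summable_gap. Qed.

Let s_served_w : summable_word (fun x => gap x * served gamma w x).
Proof.
apply: (summable_gap_bounded (C := W * gp)) => x.
exact: (norm_served_w gamma_ge0 gp_ge w_ge1 w_le W_ge1).
Qed.

Let s_total : summable_word (fun x => gap x * total_rate gamma x).
Proof.
apply: (summable_gap_bounded (C := gp)) => x.
exact: (norm_total_rate gamma_ge0 gp_ge).
Qed.

(** The external rates cancel in [d], leaving outflow differences routed by P; each is bounded
    through [gap], and P is then transposed onto [c]. *)
Lemma inflow_gap (c : J -> R) : (forall j, 0 <= c j) ->
  \sum_j c j * `|d j| <=
  sum_word (fun x => gap x * served gamma (fun i => \sum_j p i j * c j) x).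
Proof.
move=> c0.
have ncr := norm_class_rate gamma_ge0 gp_ge.
rewrite -(sum_served gamma_ge0 gp_ge); last exact: summable_gap.
under [leRHS]eq_bigr do rewrite mulr_suml.
rewrite exchange_big/=; apply: ler_sum => j _.
have -> : d j = \sum_i p i j * (outflow gamma mu i - outflow gamma nu i).
  rewrite /d /va /vb /inflow opprD addrACA subrr add0r -sumrB.
  by apply: eq_bigr => i _; rewrite mulrBr.
rewrite (le_trans (ler_wpM2l (c0 j) (ler_norm_sum _ _ _)))// mulr_sumr.
apply: ler_sum => i _; rewrite normrM ger0_norm// mulrCA mulrA ler_wpM2l ?mulr_ge0//.
rewrite !outflowE -sum_wordB; last 2 first.
- exact: summable_wordM.
- exact: summable_wordM.
apply: le_trans (norm_sum_word _) _.
  by apply: summable_wordB; exact: summable_wordM.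
rewrite (_ : (fun x => `|_|) = fun x => gap x * class_rate gamma i x)//.
by apply/funext => x; rewrite -mulrBl normrM (ger0_norm (class_rate_ge0 gamma_ge0 _ _)).
Qed.

(** With [c = w] the transposed routing is P w = w - 1. The subtracted total rate is the strict loss
    from which the contraction comes. *)
Lemma inflow_gap_weight : \sum_j w j * `|d j| <=
  sum_word (fun x => gap x * served gamma w x) -
  sum_word (fun x => gap x * total_rate gamma x).
Proof.
apply: le_trans (inflow_gap w_ge0) _; rewrite -sum_wordB//.
rewrite (_ : (fun x => _) = (fun x => gap x * served gamma w x - gap x * total_rate gamma x))//.
apply/funext => x; rewrite -mulrBr; congr (_ * _).
rewrite -served1 -servedB; apply: eq_bigr => r _; congr (_ * _).
by rewrite [w _ in RHS]w_eq addrAC subrr add0r.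
Qed.

Lemma inflow_gap_total : \sum_j `|d j| <= sum_word (fun x => gap x * total_rate gamma x).
Proof.
rewrite (eq_bigr (fun j => 1 * `|d j|)); last by move=> j _; rewrite mul1r.
apply: le_trans (inflow_gap (fun=> ler01)) _.
apply: le_sum_word => // [|x].
  apply: (summable_gap_bounded (C := 1 * gp)) => x.
  apply: norm_served => // j; rewrite ger0_norm ?sumr_ge0// => [|i _].
    by rewrite (le_trans _ (p_le1 j))// ler_sum// => i _; rewrite mulr1.
  by rewrite mulr1.
rewrite ler_wpM2l ?gap_ge0// -[leRHS]mul1r; apply: served_le_total => // j.
by rewrite (le_trans _ (p_le1 j))// ler_sum// => i _; rewrite mulr1.
Qed.

(* The splitting [c j = va j * (a - b) + d j * b] controls the sign-sensitive
   part of the arrivals, and [c j = vb j * (a - b) + d j * a] their size. *)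
Lemma drift (g psi B : word J -> R) (eta : R) (l : seq (word J)) : uniq l ->
  (forall x, x \notin l -> g x = 0) -> 0 <= eta ->
  (forall x, 0 <= g x <= weight w x) ->
  (forall x, 0 <= B x <= 1) ->
  (forall x (r : 'I_(size x)),
     g (delete_at x r) <= g x - w (letter r) + 2 * w (letter r) * B x) ->
  (forall x j, g (rcons x j) <= g x + w j) ->
  (forall x, `|psi x| <= 1) ->
  (forall x, gap x - eta <= psi x * (mass mu x - mass nu x)) ->
  summable_word (fun x => mass nu x * weight w x) ->
  let m := sum_word (fun x => mass nu x * weight w x) in
  let phi x := g x * psi x in
  2 * m <= 1 ->
  sum_word (fun x => mass mu x * generator gamma va phi x) -
  sum_word (fun x => mass nu x * generator gamma vb phi x) <=
  - (gm - 2 * (\sum_j vb j * w j) - 2 * m * gm) * busy_gap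
  + 2 * W * gp * sum_word (fun x => gap x * B x)
  + eta * (gp + \sum_j va j) * sum_word g.
Proof.
move=> ul gl eta0 gw B01 gdel grc psi1 gpsi sm m phi m1.
have g0 x : 0 <= g x by case/andP: (gw x).
have gh x : g x <= weight w x by case/andP: (gw x).
have B0 x : 0 <= B x by case/andP: (B01 x).
have sg : summable_word g by exact: summable_finite gl.
have va0 j : 0 <= va j by exact: inflow_ge0.
have vb0 j : 0 <= vb j by exact: inflow_ge0.
pose D := \sum_j `|d j|; have D0 : 0 <= D by apply: sumr_ge0.
pose V := \sum_j va j; pose Vw := \sum_j vb j * w j.
pose G := \sum_(y <- l) g y.
have gG x : g x <= G.
  have [xl|xl] := boolP (x \in l); last by rewrite gl// sumr_ge0.
  by rewrite /G (bigD1_seq x)//= lerDl sumr_ge0.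
have nphi x : `|phi x| <= G.
  by rewrite /phi normrM (ger0_norm (g0 x)) -[leRHS]mulr1 ler_pM.
have G0 : 0 <= G by apply: sumr_ge0.
pose a := mass mu; pose b := mass nu.
have a0 x : 0 <= a x by exact: mass_ge0.
have b0 x : 0 <= b x by exact: mass_ge0.
(* In order: weight lost by services on the discrepancy, the correction where [g] need not decrease,
   the smoothing error, arrivals at the rates of [nu] on the discrepancy, and the excess inflow [d]
   met with the masses of [mu] and of [nu]. *)
pose bound x := - (gap x * served gamma w x) + 2 * W * gp * (gap x * B x)
  + eta * (gp + V) * g x + Vw * gap x + (\sum_j w j * `|d j|) * a x
  + 2 * D * (b x * weight w x).
have pointwise x : a x * generator gamma va phi x - b x * generator gamma vb phi x <=
    bound x.
  have phile y : phi y <= g y.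
    by rewrite /phi -[leRHS]mulr1 ler_wpM2l// (le_trans (ler_norm _))//.
  have phige y : - g y <= phi y.
    have := psi1 y; rewrite ler_norml => /andP[psiN _].
    by have := ler_wpM2l (g0 y) psiN; rewrite mulrN1.
  pose s := a x - b x.
  have nphile y : s * phi y <= gap x * g y.
    rewrite (le_trans (ler_norm _))// normrM ler_wpM2l// ler_norml.
    by rewrite phile phige.
  have sphi : gap x * g x - eta * g x <= s * phi x.
    by rewrite /phi mulrCA -mulrBl mulrC ler_wpM2l// mulrC.
  have service : s * (\sum_(r < size x) gamma r * (phi (delete_at x r) - phi x)) <=
     - (gap x * served gamma w x) + 2 * W * gp * (gap x * B x) + eta * gp * g x.
    apply: (@le_trans _ _ (\sum_(r < size x) gamma r *
        (gap x * (- w (letter r) + 2 * w (letter r) * B x) + eta * g x))).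
      rewrite mulr_sumr; apply: ler_sum => r _; rewrite mulrCA ler_wpM2l//.
      have := ler_wpM2l (gap_ge0 x) (gdel x r).
      have := nphile (delete_at x r); rewrite mulrBr; lra.
    rewrite (eq_bigr (fun r => (gap x * (-1 + 2 * B x)) * (gamma r * w (letter r))
      + eta * g x * gamma r)); last by move=> r _; ring.
    rewrite big_split/= -!mulr_sumr -/(served gamma w x) -/(total_rate gamma x).
    have := ler_wpM2l (mulr_ge0 (gap_ge0 x) (B0 x))
      (le_trans (ler_norm _) (norm_served_w gamma_ge0 gp_ge w_ge1 w_le W_ge1 x)).
    have := ler_wpM2l (mulr_ge0 eta0 (g0 x)) (gp_ge x).
    by lra.
  have arrival j : (va j * a x - vb j * b x) * (phi (rcons x j) - phi x) <=
      vb j * w j * gap x + w j * `|d j| * a x + 2 * `|d j| * (b x * weight w x)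
      + va j * (eta * g x).
    set c := va j * a x - vb j * b x.
    have cs1 : c = va j * s + d j * b x by rewrite /c /s /d; ring.
    have cs2 : c = vb j * s + d j * a x by rewrite /c /s /d; ring.
    have nc1 : `|c| <= va j * gap x + `|d j| * b x.
      by rewrite cs1 (le_trans (ler_normD _ _))// !normrM (ger0_norm (va0 j)) (ger0_norm (b0 x)).
    have nc2 : `|c| <= vb j * gap x + `|d j| * a x.
      by rewrite cs2 (le_trans (ler_normD _ _))// !normrM (ger0_norm (vb0 j)) (ger0_norm (a0 x)).
    have c1 : c * phi (rcons x j) <= `|c| * (g x + w j).
      rewrite (le_trans (ler_norm _))// normrM ler_wpM2l//.
      by rewrite (le_trans _ (grc x j))// ler_norml phile phige.
    have c2 : va j * (gap x * g x - eta * g x) - `|d j| * b x * g x <= c * phi x.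
      have k1 := ler_wpM2l (va0 j) sphi.
      have : `|d j * b x * phi x| <= `|d j| * b x * g x.
        rewrite normrM normrM (ger0_norm (b0 x)) ler_wpM2l ?mulr_ge0//.
        by rewrite ler_norml phile phige.
      by rewrite ler_norml => /andP[k2 _]; rewrite cs1; lra.
    have e1 := ler_wpM2l (g0 x) nc1.
    have e2 := ler_wpM2l (w_ge0 j) nc2.
    have e3 := ler_wpM2l (mulr_ge0 (normr_ge0 (d j)) (b0 x)) (gh x).
    by lra.
  have split : a x * generator gamma va phi x - b x * generator gamma vb phi x =
     s * (\sum_(r < size x) gamma r * (phi (delete_at x r) - phi x)) +
     \sum_j (va j * a x - vb j * b x) * (phi (rcons x j) - phi x).
    rewrite (eq_bigr (fun j => a x * (va j * (phi (rcons x j) - phi x)) -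
      b x * (vb j * (phi (rcons x j) - phi x)))); last by move=> j _; ring.
    by rewrite sumrB -!mulr_sumr /generator /s; ring.
  have arrivals : \sum_j (va j * a x - vb j * b x) * (phi (rcons x j) - phi x) <=
      Vw * gap x + (\sum_j w j * `|d j|) * a x + 2 * D * (b x * weight w x)
      + V * (eta * g x).
    apply: le_trans (ler_sum _ (fun j _ => arrival j)) _.
    by rewrite !big_split/= -!mulr_suml -mulr_sumr.
  by rewrite split /bound; lra.
have sL mu' v : (forall j, 0 <= v j) -> summable_word (fun x => mass mu' x * generator gamma v phi x).
  by move=> v0; exact: (summable_generator gamma_ge0 gp_ge _ v0 G0 nphi).
have sB : summable_word (fun x => gap x * B x).
  by apply: (summable_gap_bounded (C := 1)) => x; rewrite ger0_norm//; case/andP: (B01 x).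
have s1 : summable_word (fun x => - (gap x * served gamma w x)) by exact: summable_wordN.
have s2 : summable_word (fun x => 2 * W * gp * (gap x * B x)) by exact: summable_wordZ.
have s3 : summable_word (fun x => eta * (gp + V) * g x) by exact: summable_wordZ.
have s4 : summable_word (fun x => Vw * gap x) by apply: summable_wordZ; exact: summable_gap.
have s5 : summable_word (fun x => (\sum_j w j * `|d j|) * a x) by exact: summable_wordZ.
have s6 : summable_word (fun x => 2 * D * (b x * weight w x)) by exact: summable_wordZ.
have s12 := summable_wordD s1 s2.
have s123 := summable_wordD s12 s3.
have s1234 := summable_wordD s123 s4.
have s12345 := summable_wordD s1234 s5.
rewrite -sum_wordB; [|exact: sL|exact: sL].
apply: (@le_trans _ _ (sum_word bound)).
  apply: le_sum_word => //; last exact: summable_wordD.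
  by apply: summable_wordB; exact: sL.
rewrite /bound !sum_wordD// !sum_wordZ//; last exact: summable_gap.
have -> : sum_word a = 1 by exact: sum_mass.
rewrite -/m mulr1.
have -> : sum_word (fun x => - (gap x * served gamma w x)) =
    - sum_word (fun x => gap x * served gamma w x).
  under eq_fun do rewrite -mulN1r.
  by rewrite sum_wordZ// mulN1r.
set Sw := sum_word (fun x => gap x * served gamma w x).
set T := sum_word (fun x => gap x * total_rate gamma x).
have h1 : \sum_j w j * `|d j| <= Sw - T := inflow_gap_weight.
have h2 : D <= T := inflow_gap_total.
have m0 : 0 <= m by apply: sum_word_ge0 => x; rewrite mulr_ge0.
have Vw0 : 0 <= Vw by apply: sumr_ge0 => j _; rewrite mulr_ge0.
have h3 := ler_wpM2l Vw0 sum_gap_le.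
have h4 := ler_wpM2l m0 h2.
have h5 : gm * busy_gap <= T.
  rewrite -sum_wordZ; last exact: summable_busy_gap.
  apply: le_sum_word => // [|x].
    by apply: summable_wordZ; exact: summable_busy_gap.
  by rewrite mulrA mulrC ler_wpM2l ?gap_ge0// total_rate_ge_busy.
(* The terms in [Sw] cancel, leaving at most [- (1 - 2 * m) * T]; as [2 * m <= 1], [T] may be
   replaced by its lower bound [gm * busy_gap]. *)
have h6 : 0 <= (1 - 2 * m) * (T - gm * busy_gap) by rewrite mulr_ge0 ?subr_ge0.
rewrite -/V -/Vw; lra.
Qed.

End contraction.

(** * Differential inequalities *)

(** Masses determine the integrals of indicators, hence the set functions; the other fields of the
    structure are proofs, identified by proof irrelevance. *)
Lemma eq_probability_mass (R : realType) (J : finType)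
    (mu nu : probability (word J) R) : mass mu =1 mass nu -> mu = nu.
Proof.
move=> e.
have emn : mu = nu :> (set (word J) -> \bar R).
  apply/funext => A; have mA : measurable A by [].
  rewrite -(setIT A) -!integral_indic//.
  rewrite (integral_mass mu (\1_A)) (integral_mass nu (\1_A)).
  by apply: eq_integral => x _; rewrite e.
move: mu nu {e} emn => [m1 c1] [m2 c2] /= emn; subst m2; congr Probability.Pack.
move: c1 c2 => [[a1 a2] [a3] [a4] [a5] [a6] [a7] [a8]].
move=> [[b1 b2] [b3] [b4] [b5] [b6] [b7] [b8]].
have e1 := Prop_irrelevance a1 b1; subst b1.
have e2 := Prop_irrelevance a2 b2; subst b2.
have e3 := Prop_irrelevance a3 b3; subst b3.
rewrite (Prop_irrelevance a4 b4) (Prop_irrelevance a5 b5) (Prop_irrelevance a6 b6).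
by rewrite (Prop_irrelevance a7 b7) (Prop_irrelevance a8 b8).
Qed.

(** The mean value theorem on [[s, t]]; right continuity at 0 covers the case [s = 0], where no
    two-sided derivative is given. *)
Lemma le_increment (R : realType) (f df : R -> R) :
  (forall t : R, 0 < t -> is_derive t 1 f (df t)) -> f @ 0^'+ --> f 0 ->
  forall s t C : R, 0 <= s -> s < t -> (forall u, s < u -> u < t -> df u <= C) ->
  f t <= f s + C * (t - s).
Proof.
move=> fdf f0 s t C s0 st dfC.
have cf u : 0 < u -> {for u, continuous f}.
  by move=> u0; apply/differentiable_continuous/derivable1_diffP; case: (fdf u u0).
have cont : {within `[s, t], continuous f}.
  apply/continuous_within_itvP => //; split.
  - move=> u; rewrite in_itv/= => /andP[su _]; apply: cf; exact: le_lt_trans su.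
  - move: s0; rewrite le_eqVlt => /predU1P[<-//|s0].
    by apply: cvg_at_right_filter; exact: cf.
  - by apply: cvg_at_left_filter; apply: cf; exact: le_lt_trans st.
have der (u : R) : u \in `]s, t[ -> is_derive u 1 f (df u).
  by rewrite in_itv/= => /andP[su _]; apply: fdf; exact: le_lt_trans su.
have [u] := MVT st der cont.
rewrite in_itv/= => /andP[su ut] e.
by rewrite -lerBlDl e ler_wpM2r ?dfC// subr_ge0; apply: ltW.
Qed.

(* If the Lipschitz rate [f] exceeded some level at arbitrarily late times, each
   excursion would cost [E] a fixed amount; the errors [e * T] accumulated over
   enough excursions are kept below 1 by choosing [e = 1 / T] afterwards. *)
Lemma dissipation_cvg0 (R : realType) (f : R -> R) (M c D : R) :
  0 < c -> 0 <= M -> (forall t, 0 <= f t) ->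
  (forall s t : R, 0 < s -> s < t -> `|f t - f s| <= M * (t - s)) ->
  (forall T e : R, 0 < T -> 0 < e -> exists E : R -> R,
     [/\ forall t, 0 <= E t, E 0 <= D &
      forall s t C : R, 0 <= s -> s < t -> t <= T ->
        (forall u : R, s < u -> u < t -> - c * f u + e <= C) ->
        E t <= E s + C * (t - s)]) ->
  f t @[t --> +oo] --> (0 : R).
Proof.
move=> c0 M0 f0 fM fE; apply/cvgr0Pnorm_lt => eps eps0.
have [[T0 fT0]|noT] := pselect (exists T0, forall t, T0 < t -> f t < eps).
  exists T0; split; first exact: num_real.
  by move=> t T0t /=; rewrite ger0_norm// fT0.
exfalso.
have often T0 : exists2 t, T0 < t & eps <= f t.
  apply: contrapT => nt; apply: noT; exists T0 => t T0t.
  by rewrite ltNge; apply/negP => ft; apply: nt; exists t.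
(* During a time [tau] the Lipschitz bound lets [f] fall by at most [eps / 2], so an excursion above
   [eps] dissipates at least [kappa]. *)
pose tau := eps / (2 * (M + 1)).
have M1 : 0 < M + 1 by rewrite ltr_wpDl.
have tau0 : 0 < tau by rewrite divr_gt0// mulr_gt0.
have Mtau : M * tau <= eps / 2.
  have : tau * (M + 1) = eps / 2 by rewrite /tau; field; rewrite gt_eqF.
  by lra.
pose kappa := c * (eps / 2) * tau.
have kappa0 : 0 < kappa by rewrite /kappa mulr_gt0// mulr_gt0// divr_gt0.
(* The time [T] is fixed by [f] and N alone, because [e] and [E] are to be chosen after it. *)
have claim N : exists2 T, 0 < T & forall e E, 0 < e ->
    (forall s t C : R, 0 <= s -> s < t -> t <= T ->
        (forall u : R, s < u -> u < t -> - c * f u + e <= C) ->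
        E t <= E s + C * (t - s)) -> E T <= E 0 - N%:R * kappa + e * T.
  elim: N => [|N [T T0 IH]].
    exists 1 => // e E e0 HE; have := HE 0 1 e (lexx _) ltr01 (lexx _).
    rewrite mul0r !subr0; apply => u u0 _.
    by rewrite gerDr mulNr oppr_le0 mulr_ge0// ltW.
  have [t Tt ft] := often T.
  have t0 : 0 < t by exact: lt_trans Tt.
  exists (t + tau); first by rewrite addr_gt0.
  move=> e E e0 HE.
  have E1 : E T <= E 0 - N%:R * kappa + e * T.
    by apply: IH => // s u C s0 su uT; apply: HE => //; rewrite (le_trans uT)//; lra.
  have E2 : E t <= E T + e * (t - T).
    apply: HE => //; [exact: ltW|by lra|] => u _ _.
    by rewrite gerDr mulNr oppr_le0 mulr_ge0// ltW.
  have E3 : E (t + tau) <= E t + (e - c * (eps / 2)) * ((t + tau) - t).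
    apply: HE => //; [exact: ltW|by lra|] => u tu utau.
    have := fM t u t0 tu; rewrite ler_norml => /andP[fu _].
    have Mu : M * (u - t) <= M * tau by rewrite ler_wpM2l//; lra.
    have : c * (eps / 2) <= c * f u by rewrite (ler_wpM2l (ltW c0))//; lra.
    by lra.
  have tt : t + tau - t = tau by ring.
  have kE : kappa = c * (eps / 2) * tau by [].
  by rewrite tt in E3; rewrite -natr1; lra.
(* That many excursions dissipate more than [D + 1], the initial energy bound plus the error
   accumulated up to [T], which would make [E T] negative. *)
pose N := Num.bound ((D + 1) / kappa + (D + 1) ^+ 2 / kappa).
have ND : D + 1 < N%:R * kappa.
  rewrite -ltr_pdivrMr//.
  have [D1|D1] := leP 0 (D + 1).
    apply: le_lt_trans (archi_boundP _); last by rewrite addr_ge0// divr_ge0 ?exprn_ge0// ltW.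
    by rewrite lerDl divr_ge0 ?sqr_ge0// ltW.
  by rewrite (@lt_le_trans _ _ 0)// pmulr_llt0 ?invr_gt0.
have [T T0 HT] := claim N.
have Ti : 0 < T^-1 by rewrite invr_gt0.
have [E [E0 ED HE]] := fE T T^-1 T0 Ti.
have := HT T^-1 E Ti HE.
by have := E0 T; rewrite mulVf ?gt_eqF//; lra.
Qed.

(** * Uniqueness and convergence *)

Section tent.
Context (R : realFieldType).
Implicit Types (K n d : R).

Definition tent K n : R := Num.max 0 (Num.min n (2 * K - n)).

Lemma tent_ge0 K n : 0 <= tent K n.
Proof. by rewrite /tent le_max lexx. Qed.

Lemma tent_le K n : 0 <= n -> tent K n <= n.
Proof. by move=> n0; rewrite /tent ge_max n0 ge_min lexx. Qed.

Lemma tent0 K n : 2 * K <= n -> tent K n = 0.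
Proof.
move=> Kn; apply/max_idPl; rewrite ge_min subr_le0 Kn orbT//.
Qed.

(** Up to the peak at [K] the tent is the identity, so removing [d] lowers it by exactly [d]; past
    the peak, slope at most 1 allows a rise by [d], hence the correction [2 * d]. *)
Lemma tentB K n d : 0 <= d -> d <= n ->
  tent K (n - d) <= tent K n - d + 2 * d * (K < n)%R%:R.
Proof.
rewrite /tent => d0 dn; case: ltP => /= Kn;
  case: (leP n (2 * K - n)) => A1; case: (leP (n - d) (2 * K - (n - d))) => A2;
  rewrite !maxEle; case: ifP => B1; case: ifP => B2; move/negP: B1; move/negP: B2; lra.
Qed.

Lemma tentD K n d : 0 <= d -> tent K (n + d) <= tent K n + d.
Proof.
rewrite /tent => d0;
  case: (leP n (2 * K - n)) => A1; case: (leP (n + d) (2 * K - (n + d))) => A2;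
  rewrite !maxEle; case: ifP => B1; case: ifP => B2; lra.
Qed.

End tent.

(** * A smooth approximation of the absolute value *)

Section smooth_abs.
Context (R : realType) (eta : R) (eta0 : 0 < eta).

(** A differentiable substitute for the absolute value, within [eta] of it, so that the distance to
    equilibrium can be differentiated in time. *)
Definition smooth_abs (z : R) : R := Num.sqrt (z ^+ 2 + eta ^+ 2).

Let arg_gt0 z : 0 < z ^+ 2 + eta ^+ 2.
Proof. by rewrite ltr_wpDl ?sqr_ge0// exprn_gt0. Qed.

Lemma smooth_abs_gt0 z : 0 < smooth_abs z.
Proof. by rewrite sqrtr_gt0. Qed.

Lemma smooth_abs_sqr z : smooth_abs z ^+ 2 = z ^+ 2 + eta ^+ 2.
Proof. by rewrite sqr_sqrtr// ltW. Qed.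

Lemma norm_le_smooth_abs z : `|z| <= smooth_abs z.
Proof. by rewrite -sqrtr_sqr ler_wsqrtr// lerDl sqr_ge0. Qed.

Lemma eta_le_smooth_abs z : eta <= smooth_abs z.
Proof. by rewrite -[leLHS](gtr0_norm eta0) -sqrtr_sqr ler_wsqrtr// lerDr sqr_ge0. Qed.

Lemma smooth_abs_le z : smooth_abs z <= `|z| + eta.
Proof.
rewrite -(ler_pXn2r (n := 2))// ?nnegrE ?addr_ge0 ?(ltW (smooth_abs_gt0 z)) ?(ltW eta0)//.
rewrite smooth_abs_sqr sqrrD real_normK ?num_real//.
have : 0 <= `|z| * eta by rewrite mulr_ge0// ltW.
by lra.
Qed.

Definition smooth_sign z := z / smooth_abs z.

Lemma norm_smooth_sign z : `|smooth_sign z| <= 1.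
Proof.
rewrite normrM normfV (gtr0_norm (smooth_abs_gt0 z)) ler_pdivrMr ?smooth_abs_gt0//.
by rewrite mul1r norm_le_smooth_abs.
Qed.

(** With s the smoothed value, the right side is s - eta^2 / s, and s is at least both [|z|] and
    [eta]. *)
Lemma smooth_sign_mul z : `|z| - eta <= smooth_sign z * z.
Proof.
have s0 := smooth_abs_gt0 z.
rewrite mulrAC ler_pdivlMr// -expr2.
have -> : z ^+ 2 = smooth_abs z ^+ 2 - eta ^+ 2 by rewrite smooth_abs_sqr addrK.
have : 0 <= smooth_abs z * (smooth_abs z - `|z|).
  by rewrite mulr_ge0 ?subr_ge0 ?norm_le_smooth_abs// ltW.
have : 0 <= eta * (smooth_abs z - eta).
  by rewrite mulr_ge0 ?subr_ge0 ?eta_le_smooth_abs// ltW.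
by lra.
Qed.

Lemma is_derive_smooth_abs (z : R) : is_derive z 1 smooth_abs (smooth_sign z).
Proof.
have -> : smooth_abs = Num.sqrt \o (fun z => z ^+ 2 + eta ^+ 2) by [].
have d1 : is_derive z 1 (fun z : R => z ^+ 2 + eta ^+ 2) (2 * z).
  by apply: is_derive_eq; rewrite /GRing.scale/=; ring.
have d2 := @is_derive1_sqrt R (z ^+ 2 + eta ^+ 2) (arg_gt0 z).
have := @is_derive1_comp R Num.sqrt (fun z => z ^+ 2 + eta ^+ 2) z _ _ d2 d1.
rewrite (_ : _ * (2 * z) = smooth_sign z)// /smooth_sign /smooth_abs.
have s0 := smooth_abs_gt0 z; rewrite /smooth_abs in s0.
by field; rewrite gt_eqF.
Qed.

End smooth_abs.

Lemma is_derive_seq (R : realType) (I : Type) (l : seq I) (F : I -> R -> R)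
    (dF : I -> R) (t : R) :
  (forall i, is_derive t 1 (F i) (dF i)) ->
  is_derive t 1 (fun s => \sum_(i <- l) F i s) (\sum_(i <- l) dF i).
Proof.
move=> dFi; elim: l => [|i l IH].
  rewrite big_nil; under [fun s => _]funext do rewrite big_nil; exact: is_derive_cst.
rewrite big_cons; under [fun s => _]funext do rewrite big_cons.
exact: is_deriveD.
Qed.

Lemma cvg_seq (R : realType) (T I : Type) (l : seq I) (F : I -> T -> R)
    (G : I -> R) (A : set_system T) {FA : Filter A} :
  (forall i, F i @ A --> G i) ->
  (fun s => \sum_(i <- l) F i s) @ A --> \sum_(i <- l) G i.
Proof.
move=> FG; elim: l => [|i l IH].
  rewrite big_nil; under [fun s => _]funext do rewrite big_nil; exact: cvg_cst.
rewrite big_cons; under [fun s => _]funext do rewrite big_cons.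
exact: cvgD.
Qed.

(** * Small external inflow: uniqueness of the balanced state *)

Section low_load.
Context (R : realType) (J : finType) (p : J -> J -> R) (gamma : service_rates R J).
Context (gm gp : R).
Context (p_ge0 : forall i j : J, 0 <= p i j).
Context (p_le1 : forall i : J, \sum_(j : J) p i j <= 1).
Context (gamma_ge0 : forall x (r : 'I_(size x)), 0 <= gamma r).
Context (gm_gt0 : 0 < gm).
Context (gm_le : forall x : word J, x != [::] -> gm <= total_rate gamma x).
Context (gp_ge : forall x : word J, total_rate gamma x <= gp).
Context (w : J -> R) (W : R).
Context (w_ge1 : forall j, 1 <= w j) (w_le : forall j, w j <= W).
Context (w_eq : forall i, w i = 1 + \sum_j p i j * w j).
Context (W_ge1 : 1 <= W).
Context (lambda : J -> R) (lambda_ge0 : forall j, 0 <= lambda j).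
Context (small : 16 * W ^+ 2 * (\sum_j lambda j * w j) <= gm).

Let L := \sum_j lambda j * w j.
Let gp_ge0 : 0 <= gp := rate_bound_ge0 gamma_ge0 gp_ge.
Let w_ge0 j : 0 <= w j. Proof. exact: le_trans (w_ge1 j). Qed.
Let W_ge0 : 0 <= W. Proof. exact: le_trans W_ge1. Qed.
Let h0 (x : word J) : 0 <= weight w x. Proof. exact: sumr_ge0. Qed.
Let L0 : 0 <= L. Proof. by apply: sumr_ge0 => j _; rewrite mulr_ge0. Qed.
Let WL : W * L <= W ^+ 2 * L.
Proof. by rewrite expr2 -mulrA ler_peMl// mulr_ge0. Qed.
Let WLgm : W * L <= gm / 2.
Proof. by have := WL; move: small gm_gt0; rewrite -/L; lra. Qed.

Definition tent_weight (K : nat) (x : word J) : R := tent K%:R (weight w x).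

(** As every [w j] is at least 1, the weight dominates the length, so words longer than 2K lie
    beyond the foot of the tent. *)
Lemma tent_weight_finite (K : nat) (l : seq (word J)) :
  (forall x : word J, (size x <= 2 * K)%N -> x \in l) ->
  forall x, x \notin l -> tent_weight K x = 0.
Proof.
move=> lK x xl; have := contraNN (lK x) xl; rewrite -ltnNge => Kx.
apply: tent0; rewrite -natrM (le_trans _ (size_le_weight x w_ge1))//.
by rewrite ler_nat ltnW.
Qed.

(** Balance removes the [nu] term of [drift]. By [small], twice the weighted inflow of [nu] is at
    most gm/8 and [2 * m * gm] at most gm/4, so more than half of the dissipation rate [gm]
    survives. *)
Lemma balanced_drift (mu nu : probability (word J) R) (psi : word J -> R) (eta : R)
    (K : nat) :
  balanced p gamma lambda nu -> 0 <= eta ->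
  (forall x, `|psi x| <= 1) ->
  (forall x, gap mu nu x - eta <= psi x * (mass mu x - mass nu x)) ->
  sum_word (fun x => mass mu x *
    generator gamma (inflow p gamma lambda mu) (fun y => tent_weight K y * psi y) x) <=
  - (gm / 2) * busy_gap mu nu
  + 2 * W * gp * sum_word (fun x => gap mu nu x * (K%:R < weight w x)%R%:R)
  + eta * (gp + \sum_j inflow p gamma lambda mu j) * sum_word (tent_weight K).
Proof.
move=> nu0 eta0 psi1 gpsi.
have [sm m_le] := balanced_moment p_ge0 gamma_ge0 gm_gt0 gm_le gp_ge w_ge1 w_le w_eq
  W_ge1 lambda_ge0 nu0 WLgm.
have Vw := balanced_inflow p_ge0 gamma_ge0 gp_ge w_ge1 w_le w_eq W_ge1 lambda_ge0 nu0.
have [l ul lK] := words_of_bounded_size J (2 * K).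
have gl := tent_weight_finite lK.
pose m := sum_word (fun x => mass nu x * weight w x).
have mgm : m * gm <= 2 * W ^+ 2 * L by rewrite -ler_pdivlMr.
have m1 : 2 * m <= 1.
  rewrite -(ler_pM2r gm_gt0) mul1r -mulrA; move: small gm_gt0; rewrite -/L; lra.
have := drift p_ge0 p_le1 gamma_ge0 gm_le gp_ge w_ge1 w_le w_eq W_ge1 lambda_ge0
  ul gl eta0 _ _ _ _ psi1 gpsi sm m1.
move=> /(_ (fun x => (K%:R < weight w x)%R%:R)).
have -> : sum_word (fun x => mass nu x * generator gamma (inflow p gamma lambda nu)
   (fun y => tent_weight K y * psi y) x) = 0.
  rewrite -(rhs_generator p_ge0 gamma_ge0 gp_ge lambda_ge0 nu ul); last first.
    by move=> y yl; rewrite gl// mul0r.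
  by rewrite big1// => y _; rewrite nu0 mulr0.
rewrite subr0 => H; apply: le_trans (H _ _ _ _) _.
- by move=> x; rewrite tent_ge0 tent_le.
- by move=> x; case: (_ < _); rewrite ?lexx ler01.
- move=> x r; rewrite /tent_weight weight_delete_at; apply: tentB => //.
  rewrite -subr_ge0 -weight_delete_at//.
- by move=> x j; rewrite /tent_weight weight_rcons; exact: tentD.
have S0 : 0 <= busy_gap mu nu := le_trans (gap_ge0 mu nu [::]) (gap_le mu nu [::]).
rewrite -/m !lerD2r ler_wpM2r// lerN2.
by move: small Vw mgm WL gm_gt0; rewrite -/L; lra.
Qed.

(** For two balanced states the drift is zero, so the dissipation is bounded by the tail of [gap] at
    weights above K, which vanishes as K grows. *)
Lemma balanced_unique (mu nu : probability (word J) R) :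
  balanced p gamma lambda mu -> balanced p gamma lambda nu -> mu = nu.
Proof.
move=> mu0 nu0.
have S0 : 0 <= busy_gap mu nu := le_trans (gap_ge0 mu nu [::]) (gap_le mu nu [::]).
have sg := summable_gap mu nu.
(* Nothing is differentiated in time here, so the exact sign is allowed and [eta] is 0. *)
pose psi x := Num.sg (mass mu x - mass nu x).
have bound (K : nat) : gm / 2 * busy_gap mu nu <=
    2 * W * gp * sum_word (fun x => gap mu nu x * (K%:R < weight w x)%R%:R).
  have [l ul lK] := words_of_bounded_size J (2 * K).
  have gl := tent_weight_finite lK.
  have := @balanced_drift mu nu psi 0 K nu0 (lexx _).
  rewrite -(rhs_generator p_ge0 gamma_ge0 gp_ge lambda_ge0 mu ul); last first.
    by move=> y yl; rewrite gl// mul0r.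
  rewrite big1; last by move=> y _; rewrite mu0 mulr0.
  move=> H; suff : 0 <= - (gm / 2) * busy_gap mu nu +
    2 * W * gp * sum_word (fun x => gap mu nu x * (K%:R < weight w x)%R%:R) +
    0 * (gp + \sum_j inflow p gamma lambda mu j) * sum_word (tent_weight K) by lra.
  apply: H => x; first by rewrite normr_sg; case: (_ != _); rewrite ?ler01.
  by rewrite subr0 /gap /psi -normrEsg.
have tail : sum_word (fun x => gap mu nu x * (K%:R < weight w x)%R%:R) @[K --> \oo] -->
    sum_word (fun x : word J => 0 : R).
  apply: (@cvg_sum_word _ _ _ _ (gap mu nu)) => // [K x|x].
    rewrite normrM ger0_norm ?gap_ge0//; case: (_ < _) => /=.
      by rewrite normr1 mulr1.
    by rewrite normr0 mulr0 gap_ge0.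
  apply: cvg_near_cst; exists (Num.bound (weight w x)) => // K /= xK.
  rewrite ltNge (le_trans (ltW (archi_boundP (h0 x)))) ?ler_nat//.
  by rewrite mulr0.
have tail2 : 2 * W * gp * sum_word (fun x => gap mu nu x * (K%:R < weight w x)%R%:R)
    @[K --> \oo] --> 2 * W * gp * sum_word (fun x : word J => 0 : R).
  exact: cvgMr tail.
have : gm / 2 * busy_gap mu nu <= 2 * W * gp * sum_word (fun x : word J => 0 : R).
  rewrite -[leRHS](cvg_lim _ tail2)//; apply: limr_ge.
    by apply/cvg_ex; eexists; exact: tail2.
  exact: nearW.
rewrite sum_word0 mulr0 pmulr_rle0 ?divr_gt0// => S_le0.
apply: eq_probability_mass => x; apply/eqP; rewrite -subr_eq0 -normr_le0.
exact: le_trans (gap_le mu nu x) S_le0.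
Qed.

(** * Convergence along a trajectory of finite initial weight *)

Section trajectory.
Context (mu : R -> probability (word J) R) (sol : nlmp_solution p gamma lambda mu).
Context (fw : finite_weight (mu 0)).

(** A bound on the weighted inflow uniform in time, from outflows at most [gp]; since [w j >= 1] it
    also bounds the total inflow. *)
Let inflow_bound : R := \sum_j (lambda j + \sum_i p i j * gp) * w j.

Let sum_inflow_weight_le t : \sum_j inflow p gamma lambda (mu t) j * w j <= inflow_bound.
Proof. by apply: ler_sum => j _; rewrite ler_wpM2r// inflow_le. Qed.

Let sum_inflow_le t : \sum_j inflow p gamma lambda (mu t) j <= inflow_bound.
Proof.
apply: le_trans (sum_inflow_weight_le t); apply: ler_sum => j _.
by rewrite ler_peMr// inflow_ge0.
Qed.

Let inflow_bound_ge0 : 0 <= inflow_bound.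
Proof.
apply: le_trans (sum_inflow_le 0); apply: sumr_ge0 => j _.
exact: inflow_ge0.
Qed.

(** The mass at time t is its initial value plus t times the difference quotient, and that quotient
    converges. *)
Lemma mass_right_continuous y : mass (mu t) y @[t --> 0^'+] --> mass (mu 0) y.
Proof.
have [_ /(_ y) d0] := sol.
have : (mass (mu 0) y + t * ((mass (mu t) y - mass (mu 0) y) / t)) @[t --> 0^'+] -->
    mass (mu 0) y + 0 * nlmp_rhs p gamma lambda (mu 0) y.
  apply: cvgD; first exact: cvg_cst.
  apply: cvgM d0; apply: cvg_at_right_filter; exact: cvg_id.
rewrite mul0r addr0; apply: cvg_trans; apply: near_eq_cvg.
near=> t; have t0 : 0 < t by near: t; exact: nbhs_right_gt.
by field; rewrite gt_eqF.
Unshelve. all: by end_near.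
Qed.

Lemma finite_sum_increment (c : word J -> R) (l : seq (word J)) C s t : uniq l ->
  (forall y, y \notin l -> c y = 0) ->
  (forall u, 0 < u -> sum_word (fun x => mass (mu u) x *
     generator gamma (inflow p gamma lambda (mu u)) c x) <= C) ->
  0 <= s -> s < t ->
  \sum_(y <- l) c y * mass (mu t) y <= \sum_(y <- l) c y * mass (mu s) y + C * (t - s).
Proof.
move=> ul cl cC s0 st.
apply: (@le_increment _ (fun t => \sum_(y <- l) c y * mass (mu t) y)
  (fun t => \sum_(y <- l) c y * nlmp_rhs p gamma lambda (mu t) y)) => //.
- move=> u u0; apply: is_derive_seq => y; have [/(_ u y u0) d _] := sol.
  exact: is_deriveZ.
- apply: cvg_seq => y; apply: cvgMr; exact: mass_right_continuous.
- move=> u su _; rewrite (rhs_generator p_ge0 gamma_ge0 gp_ge lambda_ge0 (mu u) ul cl).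
  exact/cC/le_lt_trans/su.
Qed.

Lemma summable_initial_weight : summable_word (fun x => mass (mu 0) x * weight w x).
Proof.
have ssz : summable_word (fun x : word J => mass (mu 0) x * (size x)%:R).
  apply/integrableP; split => //; move: fw; rewrite /finite_weight.
  rewrite (integral_mass (mu 0) (fun x => (size x)%:R)).
  congr (_ < _)%E; apply: eq_integral => x _.
  by rewrite /= ger0_norm// mulr_ge0 ?mass_ge0.
apply: summable_le (summable_wordZ W ssz) _ => x.
rewrite !ger0_norm ?mulr_ge0 ?mass_ge0// mulrCA ler_wpM2l ?mass_ge0//.
exact: weight_le_size.
Qed.

Let H0 := sum_word (fun x => mass (mu 0) x * weight w x).

(** Services only lower the truncated weight, and arrivals raise it at most at the rate of the
    weighted inflow. *)
Lemma truncated_moment (K : nat) t : 0 <= t ->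
  sum_word (fun x => mass (mu t) x * Num.min (weight w x) K%:R) <= H0 + inflow_bound * t.
Proof.
move=> t0; have K0 : 0 <= K%:R :> R by [].
have bmin x : `|Num.min (weight w x) K%:R| <= K%:R.
  by rewrite ger0_norm ?le_min ?h0 ?K0// ge_min lexx orbT.
have smin s : summable_word (fun x => mass (mu s) x * Num.min (weight w x) K%:R).
  by apply: summable_wordM bmin; exact: summable_mass.
have init : sum_word (fun x => mass (mu 0) x * Num.min (weight w x) K%:R) <= H0.
  apply: le_sum_word => // [|x]; first exact: summable_initial_weight.
  by rewrite ler_wpM2l ?mass_ge0// ge_min lexx.
have [<-|tn0] := eqVneq 0 t; first by rewrite mulr0 addr0.
have {tn0 t0} t0 : 0 < t by rewrite lt_neqAle tn0.
(* Subtracting the constant makes the truncated weight finitely supported, so that the wordwise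
   evolution equations can be summed; total mass 1 restores the constant. *)
pose c x := Num.min (weight w x) K%:R - K%:R.
have [l ul lK] := words_of_bounded_size J K.
have cl y : y \notin l -> c y = 0.
  move=> yl; have := contraNN (lK y) yl; rewrite -ltnNge => Ky.
  rewrite /c (min_idPr _) ?subrr// (le_trans _ (size_le_weight y w_ge1))//.
  by rewrite ler_nat ltnW.
have cE s : \sum_(y <- l) c y * mass (mu s) y =
    sum_word (fun x => mass (mu s) x * Num.min (weight w x) K%:R) - K%:R.
  have eK : sum_word (fun x => K%:R * mass (mu s) x) = K%:R.
    by rewrite sum_wordZ ?sum_mass ?mulr1//; exact: summable_mass.
  rewrite -[X in _ = _ - X]eK.
  rewrite -sum_wordB//; last by apply: summable_wordZ; exact: summable_mass.
  rewrite -(@sum_word_finite _ _ (fun x => c x * mass (mu s) x))//; last first.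
    by move=> x xl; rewrite cl// mul0r.
  by congr sum_word; apply/funext => x; rewrite /c; ring.
have := @finite_sum_increment c l inflow_bound 0 t ul cl _ (lexx _) t0.
rewrite !cE subr0 => H.
suff : sum_word (fun x => mass (mu t) x * Num.min (weight w x) K%:R) - K%:R <=
  sum_word (fun x => mass (mu 0) x * Num.min (weight w x) K%:R) - K%:R + inflow_bound * t.
  by lra.
apply: H => u u0; apply: le_trans (sum_inflow_weight_le u).
set V := \sum_j _; rewrite -[leRHS]mulr1 -(sum_mass (mu u)) -sum_wordZ; last first.
  exact: summable_mass.
apply: le_sum_word => [||x].
- apply: (summable_generator gamma_ge0 gp_ge (mu u) _ (_ : 0 <= K%:R + K%:R)) => //.
  + by move=> j; exact: inflow_ge0.
  + by move=> x; rewrite (le_trans (ler_normB _ _))// lerD// ger0_norm.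
- by apply: summable_wordZ; exact: summable_mass.
- rewrite mulrC ler_wpM2r ?mass_ge0// -[leRHS]add0r lerD//.
    rewrite sumr_le0// => r _; rewrite mulr_ge0_le0// /c weight_delete_at.
    have : weight w x - w (letter r) <= weight w x by rewrite gerBl.
    by case: (leP (weight w x) K%:R); case: (leP (weight w x - w (letter r)) K%:R); lra.
  apply: ler_sum => j _; rewrite ler_wpM2l ?inflow_ge0// /c weight_rcons.
  have := w_ge0 j.
  by case: (leP (weight w x) K%:R); case: (leP (weight w x + w j) K%:R); lra.
Qed.

Lemma mass_lipschitz y s t : 0 < s -> s < t ->
  `|mass (mu t) y - mass (mu s) y| <= (gp + inflow_bound) * (t - s).
Proof.
move=> s0 st.
have jb u x : `|jump gamma (inflow p gamma lambda (mu u)) x y| <= gp + inflow_bound.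
  rewrite jumpE; apply: le_trans (norm_generator gamma_ge0 gp_ge _ (@ler01 R) _ _) _.
  - by move=> j; exact: inflow_ge0.
  - by move=> r; do 2 case: (_ == _); rewrite ?subrr ?subr0 ?sub0r ?normrN ?normr1 ?normr0.
  - by move=> j; do 2 case: (_ == _); rewrite ?subrr ?subr0 ?sub0r ?normrN ?normr1 ?normr0.
  - by rewrite mul1r lerD2l.
have rb u : `|nlmp_rhs p gamma lambda (mu u) y| <= gp + inflow_bound.
  rewrite nlmp_rhsE; have sm := summable_mass (mu u).
  have sj : summable_word (fun x =>
      mass (mu u) x * jump gamma (inflow p gamma lambda (mu u)) x y).
    exact: summable_wordM (jb u).
  rewrite (le_trans (norm_sum_word sj))// -[leRHS]mulr1 -(sum_mass (mu u)) -sum_wordZ//.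
  apply: le_sum_word => [||x]; [exact: summable_norm|exact: summable_wordZ|].
  by rewrite normrM (ger0_norm (mass_ge0 _ _)) mulrC ler_wpM2r ?mass_ge0.
have [d _] := sol.
rewrite ler_norml; apply/andP; split.
  have := @le_increment _ (fun t => - mass (mu t) y)
    (fun t => - nlmp_rhs p gamma lambda (mu t) y) _ _ s t (gp + inflow_bound) (ltW s0) st _.
  move=> H; suff : - mass (mu t) y <= - mass (mu s) y + (gp + inflow_bound) * (t - s) by lra.
  apply: H => [u u0||u _ _].
  - by have := d u y u0; exact: is_deriveN.
  - by apply: cvgN; exact: mass_right_continuous.
  - by have := rb u; rewrite ler_norml; lra.
rewrite lerBlDl.
apply: (@le_increment _ (fun t => mass (mu t) y)
    (fun t => nlmp_rhs p gamma lambda (mu t) y)) => [|||u _ _].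
- exact: mass_right_continuous.
- exact: ltW.
- exact: st.
- by have := rb u; rewrite ler_norml; lra.
Qed.

(** [dissipation_cvg0] is applied with the smoothed, tent-weighted distance to [nu] as energy; given
    the horizon [T] and the error [e], first K and then [eta] are chosen. *)
Lemma solution_cvg_balanced nu x : balanced p gamma lambda nu ->
  `|mass (mu t) x - mass nu x| @[t --> +oo] --> (0 : R).
Proof.
move=> nu0.
have [sm _] := balanced_moment p_ge0 gamma_ge0 gm_gt0 gm_le gp_ge w_ge1 w_le w_eq
  W_ge1 lambda_ge0 nu0 WLgm.
pose m := sum_word (fun x => mass nu x * weight w x).
have m0 : 0 <= m by apply: sum_word_ge0 => y; rewrite mulr_ge0 ?mass_ge0.
have H00 : 0 <= H0 by apply: sum_word_ge0 => y; rewrite mulr_ge0 ?mass_ge0.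
apply: (@dissipation_cvg0 _ _ (gp + inflow_bound) (gm / 2) (H0 + m + 1)).
- by rewrite divr_gt0.
- by rewrite addr_ge0.
- by [].
- move=> s t s0 st; apply: le_trans (mass_lipschitz x s0 st).
  rewrite (le_trans (ler_dist_dist _ _))// (_ : _ - _ - _ = mass (mu t) x - mass (mu s) x)//.
  by ring.
move=> T e T0 e0.
have e20 : 0 < e / 2 by rewrite divr_gt0.
(* By a Markov bound on the tail above weight K, the cut-off error up to time [T] is at most
   [B / K]; the next choice makes this at most [e / 2]. *)
pose B := 2 * W * gp * (H0 + inflow_bound * T + m).
have B0 : 0 <= B by rewrite !mulr_ge0// !addr_ge0// mulr_ge0// ltW.
pose K := (Num.bound (B / (e / 2))).+1.
have K0 : 0 < K%:R :> R by rewrite ltr0n.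
have BK : B / K%:R <= e / 2.
  rewrite ler_pdivrMr// mulrC -ler_pdivrMr//.
  rewrite (le_trans (ltW (archi_boundP _)))// ?ler_nat//.
  by rewrite divr_ge0// ltW.
have [l ul lK] := words_of_bounded_size J (2 * K).
have gl := tent_weight_finite lK.
pose G := sum_word (tent_weight K).
have G0 : 0 <= G by apply: sum_word_ge0 => y; exact: tent_ge0.
pose Q := (gp + inflow_bound + 1) * (G + 1).
have Q0 : 0 < Q by rewrite mulr_gt0// ltr_wpDl// addr_ge0.
(* The smoothing then costs at most [e / 2] in the drift and at most 1 in [E 0], which is the 1 in
   [H0 + m + 1]. *)
pose eta := Num.min (e / 2) 1 / Q.
have eta0 : 0 < eta by rewrite divr_gt0// lt_min e20 ltr01.
have etaQ : eta * Q = Num.min (e / 2) 1 by rewrite /eta divfK// gt_eqF.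
have etaG : eta * G <= 1.
  apply: (@le_trans _ _ (eta * Q)); last by rewrite etaQ ge_min lexx orbT.
  rewrite ler_wpM2l ?(ltW eta0)// /Q.
  have : 0 <= (gp + inflow_bound) * (G + 1) by rewrite mulr_ge0 ?addr_ge0.
  by lra.
have etaV : eta * (gp + inflow_bound) * G <= e / 2.
  apply: (@le_trans _ _ (eta * Q)); last by rewrite etaQ ge_min lexx.
  rewrite -mulrA ler_wpM2l ?(ltW eta0)// /Q.
  have : 0 <= gp + inflow_bound by rewrite addr_ge0.
  by lra.
pose sigma t y := mass (mu t) y - mass nu y.
pose E t := \sum_(y <- l) tent_weight K y * smooth_abs eta (sigma t y).
pose dE t := \sum_(y <- l) (tent_weight K y * smooth_sign eta (sigma t y)) *
  nlmp_rhs p gamma lambda (mu t) y.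
have GE : G = \sum_(y <- l) tent_weight K y by exact: sum_word_finite.
exists E; split.
- move=> t; apply: sumr_ge0 => y _; rewrite mulr_ge0 ?tent_ge0//.
  exact/ltW/smooth_abs_gt0.
- apply: (@le_trans _ _ (\sum_(y <- l)
     (mass (mu 0) y * weight w y + mass nu y * weight w y + eta * tent_weight K y))).
    apply: ler_sum => y _.
    have := ler_wpM2l (tent_ge0 K%:R (weight w y)) (smooth_abs_le eta0 (sigma 0 y)).
    have t1 : tent_weight K y <= weight w y by exact: tent_le.
    have := ler_wpM2r (normr_ge0 (sigma 0 y)) t1.
    have s1 : `|sigma 0 y| <= mass (mu 0) y + mass nu y.
      by rewrite (le_trans (ler_normB _ _))// !ger0_norm ?mass_ge0.
    have := ler_wpM2l (h0 y) s1.
    by rewrite -/(tent_weight K y); lra.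
  rewrite !big_split/= -mulr_sumr -GE lerD// lerD//.
    apply: sum_seq_le_sum_word => // [|y]; first exact: summable_initial_weight.
    by rewrite mulr_ge0 ?mass_ge0.
  by apply: sum_seq_le_sum_word => // y; rewrite mulr_ge0 ?mass_ge0.
move=> s t C s0 st tT HC.
apply: (@le_increment _ E dE) => // [u u0||u su ut].
- have [d _] := sol; rewrite /E /dE.
  apply: is_derive_seq => y; rewrite -mulrA; apply: is_deriveZ.
  have dsig : is_derive u 1 (sigma^~ y) (nlmp_rhs p gamma lambda (mu u) y).
    rewrite -[nlmp_rhs _ _ _ _ _]subr0; apply: is_deriveB; exact: d.
  exact: (@is_derive1_comp _ (smooth_abs eta) (sigma^~ y) u _ _
    (is_derive_smooth_abs eta0 (sigma u y)) dsig).
- apply: cvg_seq => y; apply: cvgMr.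
  have cs : continuous (smooth_abs eta).
    move=> z; apply/differentiable_continuous/derivable1_diffP.
    by case: (is_derive_smooth_abs eta0 z).
  apply: continuous_cvg; first exact: cs.
  by apply: cvgB; [exact: mass_right_continuous|exact: cvg_cst].
have u0 : 0 < u by exact: le_lt_trans su.
apply: le_trans (HC u su ut).
rewrite /dE (rhs_generator p_ge0 gamma_ge0 gp_ge lambda_ge0 (mu u) ul); last first.
  by move=> y yl; rewrite gl// mul0r.
apply: le_trans (@balanced_drift (mu u) nu _ eta K nu0 (ltW eta0) _ _) _.
- by move=> y; exact: norm_smooth_sign.
- by move=> y; exact: smooth_sign_mul.
(* The total dissipation dominates the discrepancy at the single word [x], the only one followed
   here. *)
have gx := gap_le (mu u) nu x.
have gm20 : 0 <= gm / 2 by rewrite divr_ge0// ltW.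
have := ler_wpM2l gm20 gx; rewrite -/G.
have tail : sum_word (fun y => gap (mu u) nu y * (K%:R < weight w y)%R%:R) <=
    (H0 + inflow_bound * T + m) / K%:R.
  have bmin y : `|Num.min (weight w y) K%:R| <= K%:R.
    by rewrite ger0_norm ?le_min ?h0 ?(ltW K0)// ge_min lexx orbT.
  have sminm : summable_word (fun y => mass (mu u) y * Num.min (weight w y) K%:R).
    by apply: summable_wordM bmin; exact: summable_mass.
  have sK : summable_word (fun y => gap (mu u) nu y * (K%:R < weight w y)%R%:R).
    apply: (summable_wordM (C := 1)); first exact: summable_gap.
    by move=> y; case: (_ < _); rewrite ?normr1 ?normr0.
  rewrite ler_pdivlMr// mulrC -sum_wordZ//.
  apply: (@le_trans _ _ (sum_word (fun y => mass (mu u) y * Num.min (weight w y) K%:R) + m)).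
    rewrite -sum_wordD//; apply: le_sum_word => [||y].
    - exact: summable_wordZ.
    - exact: summable_wordD.
    - have s1 : gap (mu u) nu y <= mass (mu u) y + mass nu y.
        by rewrite (le_trans (ler_normB _ _))// !ger0_norm ?mass_ge0.
      have a0 := mass_ge0 (mu u) y; have b0 := mass_ge0 nu y.
      case: ltP => /= Ky.
        rewrite mulr1.
        have := ler_wpM2l (ltW K0) s1; have := ler_wpM2l b0 (ltW Ky); lra.
      by rewrite !mulr0 addr_ge0// mulr_ge0.
  rewrite lerD2r (le_trans (truncated_moment K (ltW u0)))// lerD2l ler_wpM2l//.
  by rewrite (le_trans (ltW ut)).
have c0 : 0 <= 2 * W * gp by rewrite !mulr_ge0.
have := ler_wpM2l c0 tail; rewrite mulrA -/B => tB.
have : eta * (gp + \sum_j inflow p gamma lambda (mu u) j) * G <=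
    eta * (gp + inflow_bound) * G.
  by rewrite ler_wpM2r// ler_wpM2l ?(ltW eta0)// lerD2l.
rewrite /gap; lra.
Qed.

End trajectory.
End low_load.

(** * The routing matrix *)

Lemma eigenvalue_le_spectral_radius (R : realType) (n : nat) (A : 'M[R]_n) (z : R) :
  eigenvalue A z -> `|z| <= spectral_radius A.
Proof.
move=> Az; have Az' : eigenvalue (map_mx (real_complex R) A) (real_complex R z).
  by rewrite eigenvalue_map.
have -> : `|z| = Normc.normc (real_complex R z).
  by rewrite /Normc.normc /= expr0n addr0 sqrtr_sqr.
apply: ub_le_sup; last by exists (real_complex R z).
have [r chE] := closed_field_poly_normal (char_poly (map_mx (real_complex R) A)).
have n0 (c : R[i]) : 0 <= Normc.normc c by case: c => a b; exact: sqrtr_ge0.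
(* A supremum is an upper bound only for a bounded set: the eigenvalues lie among the finitely many
   roots [r] of the characteristic polynomial. *)
exists (\sum_(c <- r) Normc.normc c) => _ [c /= Ac <-].
have cr : c \in r.
  move: Ac; rewrite eigenvalue_root_char chE rootZ ?root_prod_XsubC//.
  by rewrite (monicP (char_poly_monic _)) oner_eq0.
by rewrite (big_rem c)//= lerDl sumr_ge0.
Qed.

Section traffic.
Context (R : realType) (J : finType) (p : J -> J -> R).
Context (p_ge0 : forall i j : J, 0 <= p i j).
Context (p_le1 : forall i : J, \sum_(j : J) p i j <= 1).
Context (p_open : spectral_radius (routing_matrix p) < 1).

Let P := routing_matrix p.

(** A nontrivial kernel of I - P would make 1 an eigenvalue of P, against spectral radius below
    1. *)
Lemma routing_unit : 1%:M - P \in unitmx.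
Proof.
have /negP : ~ eigenvalue P 1.
  by move=> /eigenvalue_le_spectral_radius; rewrite normr1 leNgt p_open.
rewrite /eigenvalue negbK /eigenspace kermx_eq0 row_free_unit.
move=> unitP; rewrite -opprB -scaleN1r unitmxZ//; exact: unitrN1.
Qed.

Let sum_enum_val (F : J -> R) : \sum_(k < #|J|) F (enum_val k) = \sum_j F j.
Proof. by rewrite (reindex (@enum_val _ J))//=; exact/onW_bij/enum_val_bij. Qed.

Lemma routing_solve_col (b : J -> R) :
  exists x : J -> R, forall i, x i - \sum_j p i j * x j = b i.
Proof.
pose X : 'cV[R]_#|J| := invmx (1%:M - P) *m \col_k b (enum_val k).
have e : (1%:M - P) *m X = \col_k b (enum_val k) by rewrite mulKVmx// routing_unit.
exists (fun i => X (enum_rank i) 0) => i.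
have := congr1 (fun M : 'cV[R]__ => M (enum_rank i) 0) e.
rewrite mulmxBl mul1mx !mxE enum_rankK => <-; congr (_ - _).
rewrite -sum_enum_val; apply: eq_bigr => k _.
by rewrite enum_valK [P _ _]mxE enum_rankK.
Qed.

Lemma routing_solve_row (b : J -> R) :
  exists x : J -> R, forall j, x j - \sum_i p i j * x i = b j.
Proof.
pose X : 'rV[R]_#|J| := (\row_k b (enum_val k)) *m invmx (1%:M - P).
have e : X *m (1%:M - P) = \row_k b (enum_val k) by rewrite mulmxKV// routing_unit.
exists (fun i => X 0 (enum_rank i)) => i.
have := congr1 (fun M : 'rV[R]__ => M 0 (enum_rank i)) e.
rewrite mulmxBr mulmx1 !mxE enum_rankK => <-; congr (_ - _).
rewrite -sum_enum_val; apply: eq_bigr => k _.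
by rewrite enum_valK [P _ _]mxE enum_rankK mulrC.
Qed.

(* At a negative minimum of [x] the substochastic average [P x] is at least
   that minimum. *)
Lemma routing_col_ge0 (x : J -> R) :
  (forall i, 0 < x i - \sum_j p i j * x j) -> forall i, 0 <= x i.
Proof.
move=> xP i; case: (@Order.TotalTheory.arg_minP _ _ _ i predT x) => // i0 _ min.
rewrite (le_trans _ (min i isT))// leNgt; apply/negP => xi0.
have := xP i0; apply/negP; rewrite -leNgt subr_le0.
apply: (@le_trans _ _ ((\sum_j p i0 j) * x i0)); last first.
  by rewrite mulr_suml; apply: ler_sum => j _; rewrite ler_wpM2l// min.
by rewrite -[leLHS]mul1r ler_wnM2r// ltW.
Qed.

Lemma exists_class_weight : exists w : J -> R,
  (forall i, 1 <= w i) /\ (forall i, w i = 1 + \sum_j p i j * w j).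
Proof.
have [w wE] := routing_solve_col (fun=> 1).
have w0 : forall i, 0 <= w i by apply: routing_col_ge0 => i; rewrite wE.
have wE' i : w i = 1 + \sum_j p i j * w j by rewrite -(wE i) subrK.
exists w; split=> // i; rewrite wE' lerDl sumr_ge0// => j _.
by rewrite mulr_ge0.
Qed.

Lemma routing_duality (lambda v x : J -> R) :
  (forall j, v j - \sum_i p i j * v i = lambda j) ->
  \sum_j v j * (x j - \sum_k p j k * x k) = \sum_j lambda j * x j.
Proof.
move=> vE; under [RHS]eq_bigr do rewrite -vE mulrBl mulr_suml.
under [LHS]eq_bigr do rewrite mulrBr mulr_sumr.
rewrite !sumrB; congr (_ - _); rewrite exchange_big/=.
by apply: eq_bigr => j _; apply: eq_bigr => k _; ring.
Qed.

(** Both claims on [v] come from [routing_duality]: testing with [w] gives the total, and testing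
    with a nonnegative x for which (I - P) x is close to the indicator of [j] gives [0 <= v j]. *)
Lemma exists_traffic (w lambda : J -> R) :
  (forall i, w i = 1 + \sum_j p i j * w j) -> (forall j, 0 <= lambda j) ->
  exists v : J -> R, [/\ forall j, 0 <= v j,
    forall j, v j = lambda j + \sum_i p i j * v i &
    \sum_j v j = \sum_j lambda j * w j].
Proof.
move=> wE lambda0; have [v vE] := routing_solve_row lambda.
have vw : \sum_j v j = \sum_j lambda j * w j.
  rewrite -(routing_duality _ vE); apply: eq_bigr => j _.
  by rewrite {1}wE addrK mulr1.
exists v; split=> // [j|j]; last by rewrite -(vE j) subrK.
apply/ler_addgt0Pr => e e0; pose d := e / (`|\sum_j v j| + 1).
have n1 : 0 < `|\sum_j v j| + 1 by rewrite ltr_wpDl.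
have d0 : 0 < d by rewrite divr_gt0.
(* [routing_col_ge0] asks for a strictly positive right side, hence the shift [d], chosen so that
   its contribution stays below the arbitrary [e]. *)
have [x xE] := routing_solve_col (fun i => (i == j)%:R + d).
have x0 : forall i, 0 <= x i.
  by apply: routing_col_ge0 => i; rewrite xE ltr_wpDl.
have := routing_duality x vE; under eq_bigr do rewrite xE mulrDr.
rewrite big_split/= (bigD1 j)//= eqxx mulr1 big1 ?addr0; last first.
  by move=> i /negbTE ->; rewrite mulr0.
rewrite -mulr_suml => sE.
have : 0 <= v j + (\sum_i v i) * d by rewrite sE sumr_ge0// => i _; rewrite mulr_ge0.
move=> /le_trans; apply; rewrite lerD2l.
apply: (@le_trans _ _ ((`|\sum_i v i| + 1) * d)).
  by rewrite ler_wpM2r ?(ltW d0)// (le_trans (ler_norm _))// lerDl.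
by rewrite /d mulrC divfK// gt_eqF.
Qed.

End traffic.

(** * Existence of a stationary state *)

Section word_pmf.
Context (R : realType) (J : finType).

Record word_pmf := WordPmf {
  pmf_fun :> word J -> R;
  pmf_ge0 : forall x, 0 <= pmf_fun x;
  pmf_summable : summable_word pmf_fun;
  pmf_sum : sum_word pmf_fun = 1 }.

Definition pmf_measure (q : word_pmf) (A : set (word J)) : \bar R :=
  (\int[@counting (word J) R]_(x in A) (q x)%:E)%E.

Section instance.
Context (q : word_pmf).

Let pmf0 : pmf_measure q set0 = 0%E.
Proof. exact: integral_set0. Qed.

Let pmf_measure_ge0 A : (0 <= pmf_measure q A)%E.
Proof. by apply: integral_ge0 => x _; rewrite lee_fin pmf_ge0. Qed.

Let pmf_sigma_additive : semi_sigma_additive (pmf_measure q).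
Proof.
move=> /= A mA tA mUA; rewrite /pmf_measure ge0_integral_bigcup//; last first.
  by move=> x _; rewrite lee_fin pmf_ge0.
by apply: is_cvg_ereal_nneg_natsum_cond => n _ _; exact: pmf_measure_ge0.
Qed.

HB.instance Definition _ := isMeasure.Build _ _ _ (pmf_measure q)
  pmf0 pmf_measure_ge0 pmf_sigma_additive.

Let pmf_setT : pmf_measure q setT = 1%E.
Proof.
rewrite -[RHS](congr1 EFin (pmf_sum q)) /sum_word /Rintegral fineK//.
exact: (integrable_fin_num _ (pmf_summable q)).
Qed.

HB.instance Definition _ := Measure_isProbability.Build _ _ R (pmf_measure q) pmf_setT.

End instance.

Definition pmf_probability (q : word_pmf) : probability (word J) R := pmf_measure q.

Lemma mass_pmf (q : word_pmf) x : mass (pmf_probability q) x = q x.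
Proof.
rewrite /mass /= /pmf_measure integral_word1; last by move=> y; rewrite lee_fin pmf_ge0.
by rewrite [X in (_ * X)%E]counting1 mule1.
Qed.

End word_pmf.

(** * Invariant measure of the chain with fixed inflow *)

Section invariant_weights.
Context (R : realType) (J : finType) (gamma : service_rates R J) (gm gp : R).
Context (gamma_ge0 : forall x (r : 'I_(size x)), 0 <= gamma r).
Context (gm_gt0 : 0 < gm).
Context (gm_le : forall x : word J, x != [::] -> gm <= total_rate gamma x).
Context (gp_ge : forall x : word J, total_rate gamma x <= gp).
Context (v : J -> R) (v_ge0 : forall j, 0 <= v j).

Let V := \sum_j v j.
Context (v_small : V < gm).

Let gp_ge0 : 0 <= gp := rate_bound_ge0 gamma_ge0 gp_ge.
Let V_ge0 : 0 <= V. Proof. exact: sumr_ge0. Qed.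

(** Every jump rate is at most [gp + V]; the extra 1 keeps the clock positive. *)
Definition killed_clock : R := gp + V + 1.

Let clock_gt0 : 0 < killed_clock.
Proof. by rewrite ltr_wpDl// addr_ge0. Qed.

(* One step of the chain uniformised at rate [killed_clock], killed at the empty
   queue; [excursion_sum] is then the occupation of an excursion from it, up to
   normalisation. *)
Definition killed_step (f : word J -> R) (x : word J) : R :=
  busy R x * (f x + killed_clock^-1 * generator gamma v f x).

Definition excursion_step (n : nat) (f : word J -> R) : R :=
  killed_clock^-1 * \sum_j v j * iter n killed_step f [:: j].

Definition excursion_sum (N : nat) (f : word J -> R) : R :=
  \sum_(n < N) excursion_step n f.

Lemma generator_linear c f g x :
  generator gamma v (fun y => c * f y + g y) x =
  c * generator gamma v f x + generator gamma v g x.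
Proof.
rewrite /generator.
rewrite (eq_bigr (fun r : 'I_(size x) => c * (gamma r * (f (delete_at x r) - f x))
  + gamma r * (g (delete_at x r) - g x))); last by move=> r _; ring.
rewrite (eq_bigr (fun j => c * (v j * (f (rcons x j) - f x))
  + v j * (g (rcons x j) - g x))); last by move=> j _; ring.
by rewrite !big_split/= -!mulr_sumr; ring.
Qed.

Lemma killed_step_linear c f g :
  killed_step (fun y => c * f y + g y) = (fun y => c * killed_step f y + killed_step g y).
Proof. by apply/funext => x; rewrite /killed_step generator_linear; ring. Qed.

Lemma iter_killed_step_linear n c f g :
  iter n killed_step (fun y => c * f y + g y) =
  (fun y => c * iter n killed_step f y + iter n killed_step g y).
Proof. by elim: n => // n IH; rewrite !iterS IH killed_step_linear. Qed.

Lemma excursion_step_linear n c f g :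
  excursion_step n (fun y => c * f y + g y) = c * excursion_step n f + excursion_step n g.
Proof.
rewrite /excursion_step iter_killed_step_linear.
rewrite (eq_bigr (fun j => c * (v j * iter n killed_step f [:: j])
  + v j * iter n killed_step g [:: j])); last by move=> j _; ring.
by rewrite big_split/= -mulr_sumr; ring.
Qed.

Lemma excursion_sum_linear N c f g :
  excursion_sum N (fun y => c * f y + g y) = c * excursion_sum N f + excursion_sum N g.
Proof.
by rewrite /excursion_sum mulr_sumr -big_split; apply: eq_bigr => n _; exact: excursion_step_linear.
Qed.

Lemma excursion_sum0 N : excursion_sum N (fun=> 0) = 0.
Proof.
have := excursion_sum_linear N 1 (fun=> 0) (fun=> 0).
under [X in excursion_sum _ X = _]eq_fun do rewrite mul1r addr0.
by lra.
Qed.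

Lemma excursion_sum_seq N (c : word J -> R) (F : word J -> word J -> R) (l : seq (word J)) :
  excursion_sum N (fun x => \sum_(y <- l) c y * F y x) =
  \sum_(y <- l) c y * excursion_sum N (F y).
Proof.
elim: l => [|y l IH].
  by rewrite big_nil; under eq_fun do rewrite big_nil; rewrite excursion_sum0.
rewrite big_cons -IH -excursion_sum_linear; congr excursion_sum; apply/funext => x.
by rewrite big_cons.
Qed.

(** The clock exceeds the total jump rate at every word, so the probability of staying put is
    nonnegative. *)
Lemma killed_step_ge0 f : (forall x, 0 <= f x) -> forall x, 0 <= killed_step f x.
Proof.
move=> f0 x; rewrite /killed_step mulr_ge0//.
have -> : f x = killed_clock^-1 * (killed_clock * f x).
  by rewrite mulrA mulVf ?mul1r// gt_eqF.
rewrite -mulrDr mulr_ge0// ?invr_ge0 ?(ltW clock_gt0)//.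
have A1 : - (total_rate gamma x * f x) <=
    \sum_(r < size x) gamma r * (f (delete_at x r) - f x).
  rewrite /total_rate mulr_suml -sumrN; apply: ler_sum => r _.
  by rewrite mulrBr lerDr mulr_ge0.
have A2 : - (V * f x) <= \sum_j v j * (f (rcons x j) - f x).
  rewrite /V mulr_suml -sumrN; apply: ler_sum => j _.
  by rewrite mulrBr lerDr mulr_ge0.
have A3 := ler_wpM2r (f0 x) (gp_ge x).
by rewrite /generator /killed_clock; have := f0 x; lra.
Qed.

Lemma excursion_step_ge0 n f : (forall x, 0 <= f x) -> 0 <= excursion_step n f.
Proof.
move=> f0; rewrite /excursion_step mulr_ge0 ?invr_ge0 ?(ltW clock_gt0)//.
apply: sumr_ge0 => j _; rewrite mulr_ge0//.
by elim: n [:: j] => // n IH x; rewrite iterS; exact: killed_step_ge0.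
Qed.

Lemma le_excursion_sum N f g : (forall x, f x <= g x) ->
  excursion_sum N f <= excursion_sum N g.
Proof.
move=> fg; have : 0 <= excursion_sum N (fun x => (-1) * f x + g x).
  apply: sumr_ge0 => n _; apply: excursion_step_ge0 => x.
  by have := fg x; lra.
by rewrite excursion_sum_linear; lra.
Qed.

Lemma excursion_sum_telescope N f :
  excursion_sum N (fun x => (-1) * killed_step f x + f x) =
  excursion_step 0 f - excursion_step N f.
Proof.
rewrite excursion_sum_linear; elim: N => [|N IH].
  by rewrite /excursion_sum !big_ord0; ring.
have e : excursion_step N (killed_step f) = excursion_step N.+1 f.
  by rewrite /excursion_step -iterSr.
by rewrite /excursion_sum !big_ord_recr/= -!/(excursion_sum _ _) e; lra.
Qed.

(** The length is a Lyapunov function: at each busy step it falls on average by at least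
    [(gm - V) / killed_clock], and an excursion starts with one customer. *)
Lemma excursion_sum_busy N : excursion_sum N (busy R (J := J)) <= V / (gm - V).
Proof.
have gV : 0 < gm - V by rewrite subr_gt0.
pose len (x : word J) : R := (size x)%:R.
pose c := (gm - V) / killed_clock.
have c0 : 0 < c by rewrite divr_gt0.
have lyapunov (x : word J) : c * busy R x <= (-1) * killed_step len x + len x.
  rewrite /killed_step /busy; case: eqP => [->|/eqP x0] /=.
    by rewrite /len mulr0 mul0r mulr0 addr0.
  have -> : generator gamma v len x = - total_rate gamma x + V.
    rewrite (_ : len = weight (fun=> 1)); last by apply/funext => y; exact: size_weight.
    rewrite generator_weight served1; congr (_ + _).
    by apply: eq_bigr => j _; rewrite mulr1.
  have := ler_wpM2l (ltW (_ : 0 < killed_clock^-1)) (gm_le x0).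
  rewrite invr_gt0 => /(_ clock_gt0); rewrite /c; lra.
have : excursion_sum N (fun x => c * busy R x + 0) <= excursion_step 0 len.
  under [X in excursion_sum _ X]eq_fun do rewrite addr0.
  apply: le_trans (le_excursion_sum N lyapunov) _.
  by rewrite excursion_sum_telescope gerBl excursion_step_ge0.
rewrite excursion_sum_linear excursion_sum0 addr0.
rewrite /excursion_step /= (eq_bigr v) => [|j _]; last by rewrite /len mulr1.
rewrite -/V /c => H; rewrite ler_pdivlMr//.
have : killed_clock * ((gm - V) / killed_clock * excursion_sum N (busy R (J := J))) <=
    killed_clock * (killed_clock^-1 * V) by rewrite ler_wpM2l// ltW.
rewrite mulrA [killed_clock * _]mulrC divfK ?gt_eqF// mulVKf ?gt_eqF//.
by rewrite mulrC.
Qed.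

(** Expected visits during one cycle of the uniformised chain from the empty queue, which is itself
    counted once; [excursion_sum_cvg] shows that the limit exists. *)
Definition invariant_weight (x : word J) : R :=
  if x == [::] then 1 else limn (excursion_sum ^~ (fun z => (z == x)%:R)).

Lemma excursion_sum_seq_le N (l : seq (word J)) : uniq l ->
  \sum_(y <- l | y != [::]) excursion_sum N (fun z => (z == y)%:R) <= V / (gm - V).
Proof.
move=> ul; apply: le_trans (excursion_sum_busy N).
rewrite big_mkcond (eq_bigr (fun y => busy R y * excursion_sum N (fun z => (z == y)%:R))).
  rewrite -excursion_sum_seq; apply: le_excursion_sum => x.
  have [xl|xl] := boolP (x \in l).
    rewrite (bigD1_seq x)//= eqxx mulr1 big1 ?addr0// => y yx.
    by rewrite eq_sym (negbTE yx) mulr0.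
  rewrite big_seq big1 ?ler0n// => y yl; case: eqP => [xy|_]; last by rewrite mulr0.
  by move: xl; rewrite xy yl.
by move=> y _; rewrite /busy; case: ifP; rewrite ?mul1r ?mul0r.
Qed.

Lemma excursion_sum_cvg y : y != [::] ->
  excursion_sum ^~ (fun z => (z == y)%:R) @ \oo --> invariant_weight y.
Proof.
move=> y0; rewrite /invariant_weight (negbTE y0).
apply/cvg_ex; exists (sup (range (excursion_sum ^~ (fun z => (z == y)%:R)))).
apply: nondecreasing_cvgn.
  apply/nondecreasing_seqP => n; rewrite /excursion_sum big_ord_recr/= lerDl.
  exact: excursion_step_ge0.
exists (V / (gm - V)) => _ [N _ <-].
have := @excursion_sum_seq_le N [:: y] isT.
by rewrite big_cons big_nil y0 addr0.
Qed.

Lemma invariant_weight_ge0 x : 0 <= invariant_weight x.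
Proof.
have [->|x0] := eqVneq x [::]; first by rewrite /invariant_weight eqxx.
have c := excursion_sum_cvg x0; rewrite -(cvg_lim _ c)//; apply: limr_ge.
  by apply/cvg_ex; eexists; exact: c.
by apply: nearW => N; apply: sumr_ge0 => n _; apply: excursion_step_ge0.
Qed.

Lemma summable_invariant_weight : summable_word invariant_weight.
Proof.
suff [] : summable_word invariant_weight /\ sum_word invariant_weight <= 1 + V / (gm - V).
  by [].
apply: summable_bounded => [x|l ul]; first exact: invariant_weight_ge0.
rewrite (bigID (fun y => y == [::]))/= lerD//.
  rewrite (eq_bigr (fun=> 1)) => [|y /eqP ->]; last by rewrite /invariant_weight eqxx.
  have -> : \sum_(y <- l | y == [::]) 1 = (\sum_(y <- l | y == [::]) 1)%N%:R :> R.
    by rewrite natr_sum.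
  by rewrite sum1_count (count_uniq_mem _ ul) lern1 leq_b1.
have c : (fun N => \sum_(y <- l | y != [::]) excursion_sum N (fun z => (z == y)%:R)) @ \oo
    --> \sum_(y <- l | y != [::]) invariant_weight y.
  elim: (l) => [|y l' IH].
    by rewrite big_nil; under eq_fun do rewrite big_nil; exact: cvg_cst.
  rewrite big_cons; under eq_fun do rewrite big_cons.
  have [y0|//] := boolP (y != [::]).
  by apply: cvgD => //; exact: excursion_sum_cvg.
rewrite -(cvg_lim _ c)//; apply: limr_le.
  by apply/cvg_ex; eexists; exact: c.
by apply: nearW => N; exact: excursion_sum_seq_le.
Qed.

(** Telescoping the indicator of [y] over the excursion equates the net outflow from [y] along busy
    words with the entrance from the empty queue. *)
Lemma invariant_weight_jump y : y != [::] ->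
  sum_word (fun x => invariant_weight x * jump gamma v x y) = 0.
Proof.
move=> y0; pose f (z : word J) : R := (z == y)%:R.
have f_nil : f [::] = 0 by rewrite /f eq_sym (negbTE y0).
have [l ul lK] := words_of_bounded_size J (size y).+1.
have jl x : x \notin l -> jump gamma v x y = 0.
  move=> xl; have := contraNN (lK x) xl; rewrite -ltnNge => xy.
  have neq (z : word J) : (size y < size z)%N -> (z == y) = false.
    by move=> yz; apply/eqP => zy; rewrite zy ltnn in yz.
  rewrite jumpE /generator !big1 ?addr0// => [j|r] _.
    rewrite (neq x) ?(neq (rcons x j)) ?subrr ?mulr0 ?size_rcons//; lia.
  rewrite (neq x) ?(neq (delete_at x r)) ?subrr ?mulr0 ?size_delete_at//; lia.
pose rho (x : word J) : R := (-1) * killed_step f x + f x.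
have rhoE x : rho x = - (killed_clock^-1 * (busy R x * jump gamma v x y)).
  rewrite /rho /killed_step jumpE -/f /busy; case: eqP => [->|_] /=.
    by rewrite f_nil !mul0r; ring.
  by ring.
have rhol x : x \notin l -> rho x = 0 by move=> xl; rewrite rhoE jl// !mulr0 oppr0.
have c1 : excursion_sum ^~ rho @ \oo --> \sum_(z <- l) rho z * invariant_weight z.
  rewrite {1}(finite_support_word ul rhol).
  under eq_fun do rewrite excursion_sum_seq.
  apply: cvg_seq => z; have [->|z0] := eqVneq z [::].
    have -> : rho [::] = 0 by rewrite rhoE /busy eqxx mul0r mulr0 oppr0.
    by under eq_fun do rewrite mul0r; rewrite mul0r; exact: cvg_cst.
  by apply: cvgMr; exact: excursion_sum_cvg.
have c2 : excursion_sum ^~ rho @ \oo --> excursion_step 0 f - 0.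
  under eq_fun do rewrite excursion_sum_telescope.
  (* The remainder [excursion_step N f] is the difference of consecutive partial sums of a
     convergent series, so it tends to 0. *)
  apply: cvgB; first exact: cvg_cst.
  have cf := excursion_sum_cvg y0.
  have cfS : (fun N => excursion_sum N.+1 f) @ \oo --> invariant_weight y.
    by rewrite (cvg_shiftS (excursion_sum ^~ f)).
  have -> : excursion_step ^~ f = (fun N => excursion_sum N.+1 f - excursion_sum N f).
    by apply/funext => N; rewrite /excursion_sum big_ord_recr/= addrAC subrr add0r.
  have -> : 0 = invariant_weight y - invariant_weight y :> R by rewrite subrr.
  exact: cvgB cfS cf.
have e : \sum_(z <- l) rho z * invariant_weight z = excursion_step 0 f.
  by rewrite -[RHS]subr0; exact: cvg_unique c1 c2.
rewrite (@sum_word_finite _ _ _ l)//; last by move=> x xl; rewrite jl// mulr0.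
have nl : [::] \in l by exact: lK.
rewrite (bigD1_seq [::])//=.
have -> : invariant_weight [::] = 1 by rewrite /invariant_weight eqxx.
have j0 : jump gamma v [::] y = killed_clock * excursion_step 0 f.
  rewrite /excursion_step mulrA mulfV ?gt_eqF// mul1r /jump big_ord0 add0r.
  apply: eq_bigr => j _ /=; rewrite -/(f _) -/(f [::]) f_nil subr0//.
rewrite mul1r j0 -e mulr_sumr [X in X + _](bigD1_seq [::])//=.
have -> : rho [::] = 0 by rewrite rhoE /busy eqxx mul0r mulr0 oppr0.
rewrite mul0r mulr0 add0r -big_split/= big1// => z z0.
rewrite rhoE /busy z0 mul1r.
by field; rewrite gt_eqF.
Qed.

Lemma exists_invariant_probability : exists nu : probability (word J) R,
  forall y, y != [::] -> sum_word (fun x => mass nu x * jump gamma v x y) = 0.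
Proof.
pose Z := sum_word invariant_weight.
have sq := summable_invariant_weight.
have Z0 : 0 < Z.
  apply: (@lt_le_trans _ _ (invariant_weight [::])).
    by rewrite /invariant_weight eqxx.
  by apply: le_sum_word_point => // x; exact: invariant_weight_ge0.
have q0 x : 0 <= Z^-1 * invariant_weight x.
  by rewrite mulr_ge0 ?invariant_weight_ge0// invr_ge0 ltW.
have sZ : sum_word (fun x => Z^-1 * invariant_weight x) = 1.
  by rewrite sum_wordZ// -/Z mulVf// gt_eqF.
exists (pmf_probability (WordPmf q0 (summable_wordZ _ sq) sZ)) => y y0.
under eq_fun do rewrite mass_pmf/= -mulrA.
rewrite sum_wordZ ?invariant_weight_jump ?mulr0//.
apply: (summable_wordM (C := 1 * (gp + \sum_j v j))) => // x.
rewrite jumpE; apply: norm_generator => // [r|j];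
  by do 2 case: (_ == _); rewrite ?subrr ?subr0 ?sub0r ?normrN ?normr1 ?normr0.
Qed.

End invariant_weights.

(** * From the linear chain to the nonlinear equilibrium *)

Section existence.
Context (R : realType) (J : finType) (p : J -> J -> R) (gamma : service_rates R J) (gm gp : R).
Context (gamma_ge0 : forall x (r : 'I_(size x)), 0 <= gamma r).
Context (gm_gt0 : 0 < gm).
Context (gm_le : forall x : word J, x != [::] -> gm <= total_rate gamma x).
Context (gp_ge : forall x : word J, total_rate gamma x <= gp).

(** Testing the invariant law with the number of class-j customers identifies its outflow with [v].
    The traffic equation then makes its inflow [v] too, so the linear balance is the nonlinear
    one. *)
Lemma exists_balanced (lambda v : J -> R) :
  (forall j, 0 <= v j) -> (forall j, v j = lambda j + \sum_i p i j * v i) ->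
  \sum_j v j < gm -> exists nu, balanced p gamma lambda nu.
Proof.
move=> v0 vE vgm.
have [nu nuj] := exists_invariant_probability gamma_ge0 gm_gt0 gm_le gp_ge v0 vgm.
exists nu; have sm := summable_mass nu.
have lip := sum_generator_lipschitz gamma_ge0 gp_ge sm v0 nuj.
have out j : outflow gamma nu j = v j.
  pose c (i : J) : R := (i == j)%:R.
  have c01 i : `|c i| <= 1 by rewrite /c; case: (_ == _); rewrite ?normr1 ?normr0.
  have := lip (weight c) 1 ler01.
  have cr x : served gamma c x = class_rate gamma j x.
    rewrite -sum_class_rate (bigD1 j)//= /c eqxx mul1r big1 ?addr0// => i /negbTE ->.
    by rewrite mul0r.
  have vc : \sum_i v i * c i = v j.
    rewrite (bigD1 j)//= /c eqxx mulr1 big1 ?addr0// => i /negbTE ->.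
    by rewrite mulr0.
  have sc : summable_word (fun x => mass nu x * class_rate gamma j x).
    by apply: summable_wordM => // x; exact: (norm_class_rate gamma_ge0 gp_ge).
  have -> : (fun x => mass nu x * generator gamma v (weight c) x) =
      (fun x => v j * mass nu x - mass nu x * class_rate gamma j x).
    by apply/funext => x; rewrite generator_weight cr vc; ring.
  rewrite sum_wordB//; last exact: summable_wordZ.
  rewrite sum_wordZ// sum_mass mulr1 -outflowE => H; apply/eqP.
  rewrite eq_sym -subr_eq0; apply/eqP; apply: H => [x r|x i].
    by rewrite weight_delete_at addrAC subrr add0r normrN.
  by rewrite weight_rcons addrAC subrr add0r.
have inE : inflow p gamma lambda nu = v.
  apply/funext => j; rewrite /inflow vE; congr (_ + _).
  by apply: eq_bigr => i _; rewrite out.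
move=> y; rewrite nlmp_rhsE inE.
have [->|y0] := eqVneq y [::]; last exact: nuj.
(* The balance at the empty word follows from those at the nonempty ones, since its indicator has
   bounded increments. *)
apply: (lip (fun z => (z == [::])%:R) 1 ler01) => [x r|x j];
  by do 2 case: (_ == _); rewrite ?subrr ?subr0 ?sub0r ?normrN ?normr1 ?normr0.
Qed.

End existence.

Theorem theorem5 (R : realType) (J : finType)
    (p : J -> J -> R) (gamma : service_rates R J) (gamma_minus gamma_plus : R)
    (p_ge0 : forall i j : J, 0 <= p i j)
    (p_le1 : forall i : J, \sum_(j : J) p i j <= 1)
    (p_open : spectral_radius (routing_matrix p) < 1)
    (gamma_ge0 : forall (x : word J) (r : 'I_(size x)), 0 <= gamma x r)
    (gamma_minus_gt0 : 0 < gamma_minus)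
    (gamma_minus_plus : gamma_minus <= gamma_plus)
    (gamma_bounds : forall x : word J, x <> [::] ->
       gamma_minus <= total_rate gamma x <= gamma_plus) :
  exists2 eps : R, 0 < eps &
    forall lambda : J -> R, (forall j : J, 0 <= lambda j < eps) ->
      exists mul : probability (word J) R,
        unique (stationary p gamma lambda) mul /\
        forall mu : R -> probability (word J) R,
          nlmp_solution p gamma lambda mu -> finite_weight (mu 0) ->
          forall x : word J,
            `|mass (mu t) x - mass mul x| @[t --> +oo] --> (0 : R).
Proof.
have [w [w1 wE]] := exists_class_weight p_ge0 p_le1 p_open.
(* The added 1 ensures [1 <= W] even when there are no classes. *)
pose W := 1 + \sum_j w j.
have w0 j : 0 <= w j by exact: le_trans (w1 j).
have W1 : 1 <= W by rewrite lerDl sumr_ge0.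
have wW j : w j <= W.
  by rewrite /W (bigD1 j)//= addrCA lerDl addr_ge0// sumr_ge0.
have gm_le x : x != [::] -> gamma_minus <= total_rate gamma x.
  by move=> /eqP /gamma_bounds /andP[].
have gp_ge x : total_rate gamma x <= gamma_plus.
  have [->|/eqP/gamma_bounds/andP[]//] := eqVneq x [::].
  by rewrite /total_rate big_ord0 (le_trans _ gamma_minus_plus)// ltW.
have WW : 0 < 16 * W ^+ 3 by rewrite mulr_gt0// exprn_gt0// (lt_le_trans ltr01).
(* The weighted external inflow is at most this threshold times the sum of the [w j], hence times
   [W]; one power of [W] goes there and two remain for [small]. *)
exists (gamma_minus / (16 * W ^+ 3)); first by rewrite divr_gt0.
move=> lambda lam; have lam0 j : 0 <= lambda j by case/andP: (lam j).
have LW : \sum_j lambda j * w j <= gamma_minus / (16 * W ^+ 3) * W.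
  apply: (@le_trans _ _ (\sum_j gamma_minus / (16 * W ^+ 3) * w j)).
    by apply: ler_sum => j _; rewrite ler_wpM2r// ltW//; case/andP: (lam j).
  by rewrite -mulr_sumr ler_wpM2l ?lerDr// divr_ge0// ltW.
have small : 16 * W ^+ 2 * (\sum_j lambda j * w j) <= gamma_minus.
  have W20 : 0 <= 16 * W ^+ 2 by rewrite mulr_ge0// sqr_ge0.
  apply: le_trans (ler_wpM2l W20 LW) _.
  have WN0 : W != 0 by rewrite gt_eqF// (lt_le_trans ltr01).
  have -> : 16 * W ^+ 2 * (gamma_minus / (16 * W ^+ 3) * W) = gamma_minus by field.
  exact: lexx.
have [v [v0 vE vL]] := exists_traffic p_ge0 p_le1 p_open wE lam0.
have vgm : \sum_j v j < gamma_minus.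
  rewrite vL; have L0 : 0 <= \sum_j lambda j * w j.
    by apply: sumr_ge0 => j _; rewrite mulr_ge0.
  have W2 : 1 <= W ^+ 2 by rewrite exprn_ege1.
  by have := ler_wpM2r L0 W2; lra.
have [nu nu0] := exists_balanced gamma_ge0 gamma_minus_gt0 gm_le gp_ge v0 vE vgm.
exists nu; split; first split.
- exact/stationary_balanced.
- move=> mu /stationary_balanced mu0.
  exact: (balanced_unique p_ge0 p_le1 gamma_ge0 gamma_minus_gt0 gm_le gp_ge w1 wW wE W1
    lam0 small).
- move=> mu sol fw x.
  exact: (solution_cvg_balanced p_ge0 p_le1 gamma_ge0 gamma_minus_gt0 gm_le gp_ge w1 wW wE
    W1 lam0 small).
Qed.
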